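(* Let $T=\{t_k:k\in\mathbb N\}\subset[0,\infty)$ be an infinite locally finite set, enumerated increasingly ($t_0<t_1<t_2<\cdots$), with $t_0=0$. If, for some $N\in\mathbb N^+$, $$\sum_{k=0}^{K}|t_k-Nk|^2=o(K^2)\qquad(K\to\infty),$$ then $$Q_{T,N}(r)=\sum_{k\ge0}|r^{t_k}-r^{Nk}|^2\longrightarrow0\qquad\text{as } r\uparrow1.$$ Consequently, $T\in\mathfrak U$.
   Context: $\mathbb N=\{0,1,2,\dots\}$, $\mathbb N^+=\{1,2,\dots\}$. A set $T\subset[0,\infty)$ is locally finite if $T\cap[0,R]$ is finite for every $R>0$. For a positive operator $A$ on a Hilbert space, $A^t$ is defined by continuous functional calculus for $t>0$ and $A^0=I$. The family $\{CA^t\}_{t\in T}$ is exactly observable if there are $0<a\le b<\infty$ with $a\|x\|^2\le\sum_{t\in T}\|CA^tx\|^2\le b\|x\|^2$ for all $x\in H$. $\mathfrak U$ is the class of universal time sets: locally finite $T\subset[0,\infty)$ such that for all separable complex Hilbert spaces $H,Y$, every positive $A\in\mathcal B(H)$ and every $C\in\mathcal B(H,Y)$, exact observability of $\{CA^n\}_{n\in\mathbb N}$ implies exact observability of $\{CA^t\}_{t\in T}$. *)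

(* Defs.v *)
From HB Require Import structures.
From mathcomp Require Import all_boot all_order all_algebra.
From mathcomp Require Import sesquilinear complex.
From mathcomp Require Import all_classical all_reals all_analysis.
Set Implicit Arguments.
Unset Strict Implicit.
Unset Printing Implicit Defensive.
Import Order.TTheory GRing.Theory Num.Theory.
Import numFieldNormedType.Exports.

Local Open Scope classical_set_scope.
Local Open Scope complex_scope.
Local Open Scope ring_scope.

Definition locally_finite_times {R : realType} (T : set R) : Prop :=
  T `<=` [set x | 0 <= x] /\
  forall b : R, 0 < b -> finite_set (T `&` `[0, b]).

(* A complex Hilbert space is a complete normed space over R[i] whose norm is
   induced by a positive definite hermitian form, linear in its first argument
   and conjugate-linear in its second. *)
Definition hilbert_dot {R : realType} (H : completeNormedModType R[i])
    (dot : {dot H for Num.conj}) : Prop :=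
  forall x : H, `|x| ^+ 2 = dot x x.

Definition separable_space (T : topologicalType) : Prop :=
  exists2 D : set T, countable D & dense D.

(* The norm of a normed space over R[i] takes its values in R[i]. *)
Definition rnorm {R : realType} {V : normedModType R[i]} (x : V) : R :=
  complex.Re `|x|.

(* In R[i], 0 <= z means that z is real and nonnegative. *)
Definition positive_operator {R : realType} (H : completeNormedModType R[i])
    (dot : {dot H for Num.conj}) (A : {linear H -> H}) : Prop :=
  [/\ continuous A, (forall x y : H, dot (A x) y = dot x (A y))
    & forall x : H, 0 <= dot (A x) x].

Definition spectrum {R : realType} {H : completeNormedModType R[i]}
    (A : H -> H) : set R[i] :=
  [set z | ~ exists B : {linear H -> H}, [/\ continuous B,
      (forall x, B (A x - z *: x) = x) & (forall x, A (B x) - z *: B x = x)]].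

Definition poly_op {R : realType} {H : completeNormedModType R[i]}
    (p : {poly R[i]}) (A : H -> H) : H -> H :=
  fun x => \sum_(i < size p) p`_i *: iter i A x.

(* f(A) for A self-adjoint and f continuous on the spectrum of A, as the
   extension by density of the polynomial calculus p |-> p(A): f(A) is the
   limit in operator norm of p_n(A) for all polynomials p_n converging to f
   uniformly on the spectrum of A.  As this spectrum is a compact subset of the
   real line, such sequences exist by Weierstrass, and they determine f(A). *)
Definition cfc {R : realType} {H : completeNormedModType R[i]}
    (A : H -> H) (f : R[i] -> R[i]) : H -> H :=
  get [set B : H -> H | linear B /\
    forall p : nat -> {poly R[i]},
      (forall e : R, 0 < e -> \forall n \near \oo, forall z : R[i],
         spectrum A z -> `|(p n).[z] - f z| <= e%:C) ->
      (forall e : R, 0 < e -> \forall n \near \oo, forall x : H,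
         `|poly_op (p n) A x - B x| <= e%:C * `|x|)].

(* A^t for a positive operator A and t >= 0. *)
Definition op_pow {R : realType} {H : completeNormedModType R[i]}
    (A : H -> H) (t : R) : H -> H :=
  if t == 0 then idfun
  else cfc A (fun z : R[i] => (complex.Re z `^ t)%:C).

Definition exactly_observable {R : realType}
    {H Y : completeNormedModType R[i]} {I : choiceType}
    (S : set I) (L : I -> H -> Y) : Prop :=
  exists a b : R, [/\ 0 < a, a <= b & forall x : H,
    ((a * rnorm x ^+ 2)%:E <= \esum_(i in S) (rnorm (L i x) ^+ 2)%:E)%E /\
    (\esum_(i in S) (rnorm (L i x) ^+ 2)%:E <= (b * rnorm x ^+ 2)%:E)%E].

Definition universal_times {R : realType} (T : set R) : Prop :=
  locally_finite_times T /\
  forall (H Y : completeNormedModType R[i])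
    (dotH : {dot H for Num.conj}) (dotY : {dot Y for Num.conj}),
    hilbert_dot dotH -> hilbert_dot dotY ->
    separable_space H -> separable_space Y ->
  forall (A : {linear H -> H}) (C : {linear H -> Y}),
    positive_operator dotH A -> continuous C ->
    exactly_observable [set: nat] (fun n x => C (iter n A x)) ->
    exactly_observable T (fun t x => C (op_pow A t x)).

Definition Q_series {R : realType} (t : nat -> R) (N : nat) (r : R) : \bar R :=
  (\sum_(0 <= k <oo) (`|r `^ t k - r ^+ (N * k)| ^+ 2)%:E)%E.

(* Main.v *)
(* Write [Q(l) = sum_k (l^(t_k) - l^(N k))^2].  Abel summation turns the
   hypothesis into [Q(l) <= e + C_e (1 - l)^2] on [0, 1] for every [e > 0], which
   gives [Q -> 0] and, by the functional calculus,
   [sum_k |A^(t_k) x - A^(N k) x|^2 <= e |x|^2 + C_e |x - A x|^2].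
   Since [sum_k |C A^(N k) x|^2] controls [|x|^2] up to a multiple of
   [|x - A x|^2], the lower bound for the times [t_k] reduces to a control of
   [|x - A x|].  Observability of [x - A x], together with
   [|A^M (1 - A)| <= 1 / (M + 1)], bounds it by a small multiple of [|x|] plus
   finitely many of the [|C A^j x|].  These are in turn bounded by the
   [|C A^(t_k) x|]: as [t_k = O(k)], Muntz' theorem makes [l^j] a uniform limit on
   [0, 1] of combinations of the [l^(t_k)]. *)

Require Import Defs.
From HB Require Import structures.
From mathcomp Require Import all_boot all_order all_algebra.
From mathcomp Require Import sesquilinear complex.
From mathcomp Require Import all_classical all_reals all_analysis.
From mathcomp Require Import ring lra.
Import Order.TTheory GRing.Theory Num.Theory.
Import numFieldNormedType.Exports.

Local Open Scope classical_set_scope.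
Local Open Scope ring_scope.

(** * Muntz approximation *)

(** The hypothesis makes the gap series small only near [l = 1]: for small [e] the term
    [C_e (1 - l)^2] stays, with a [C_e] that may be huge. The defect [|x - A x|] must therefore be
    bounded with an accuracy chosen after [C_e], and the Muntz approximation with one chosen after
    both. Working on [0, 1] is legitimate because observability alone forces [A] to be a
    contraction. The functional calculus is built without spectral measures. A Neumann series places
    the spectrum in [0, 1]; positivity of [q(A)], for a real polynomial [q] nonnegative on the
    spectrum, comes from maximising a lower bound of its quadratic form. Bounds on sums of squares
    of functions then pass to operators by polynomial approximation, with no loss in the number of
    terms. The Muntz estimate serves twice: with exponents 1, 2, 3, ... it supplies the polynomials
    behind [A^t], and with exponents [t_k] it recovers the powers [A^j]. *)

Lemma is_derive_expR_scaled {R : realType} (a s : R) :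
  is_derive s 1 (fun v => expR (a * v)) (a * expR (a * s)).
Proof.
have D : is_derive s 1 ( *%R a : R -> R) a.
  have := @is_deriveZ R R R id a s 1 1 (is_derive_id _ _).
  by rewrite /GRing.scale/= mulr1.
rewrite mulrC; exact: (@is_derive1_comp R expR ( *%R a) s _ _ (is_derive_expR _) D).
Qed.

Lemma is_derive_exp_sum {R : realType} (n : nat) (c d : nat -> R) (s : R) :
  is_derive s 1 (fun v => \sum_(i < n) c i * expR (d i * v))
    (\sum_(i < n) c i * (d i * expR (d i * s))).
Proof.
have := @is_derive_sum R R^o R^o n (fun i v => c i * expR (d i * v)) s 1
  (fun i => c i * (d i * expR (d i * s))).
rewrite (_ : \sum_(i < n) _ = fun v => \sum_(i < n) c i * expR (d i * v)); last first.
  by apply/funext => v; rewrite fct_sumE.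
apply=> i.
exact: (@is_deriveZ R R^o R^o (fun v => expR (d i * v)) (c i) s 1 _
  (is_derive_expR_scaled (d i) s)).
Qed.

Lemma ndecr_ge0 {R : realType} (f df : R -> R) :
  (forall s : R, is_derive s (1 : R) f (df s)) ->
  (forall s, 0 <= s -> 0 <= df s) ->
  forall s, 0 <= s -> f 0 <= f s.
Proof.
move=> fD df0 s s0; apply: (@ger0_derive1_ndecry R f 0) => //.
- move=> x; rewrite in_itv/= andbT => /ltW x0.
  by rewrite derive1E (@derive_val _ _ _ _ _ _ _ (fD x)) df0.
- apply: continuous_subspaceT => x; apply: differentiable_continuous.
  by apply/derivable1_diffP; case: (fD x).
Qed.

(* Golitschek's proof of Muntz' theorem: if [G] is the n-th remainder and [F]
   the previous one, then [(e^(u_n s) G)' = (u_n - q) e^(u_n s) F] and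
   [G 0 = 0], so that integrating multiplies the sup norm by [|1 - q / u_n|]. *)
Lemma muntz_exp {R : realType} (u : nat -> R) (q : R) (n : nat) :
  (forall i, 0 < u i) -> injective u -> 0 < q ->
  exists a : nat -> R, forall s, 0 <= s ->
    `|expR (- q * s) - \sum_(i < n) a i * expR (- u i * s)|
      <= \prod_(i < n) `|1 - q / u i|.
Proof.
move=> u0 uI q0; elim: n => [|n [a IH]].
  exists (fun=> 0) => s s0; rewrite !big_ord0 subr0 ger0_norm ?expR_ge0//.
  by rewrite -expR0 ler_expR mulNr oppr_le0 mulr_ge0 // ltW.
set M := \prod_(i < n) _ in IH *.
have M0 : 0 <= M by apply: prodr_ge0.
(* Integrating [(u n - q) e^(u_n s) F] term by term produces these coefficients; [bn] is the
   constant of integration, fixed by [H 0 = 0], and becomes the coefficient of the new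
   exponential. *)
pose b i := (u n - q) / (u n - u i) * a i.
pose bn := 1 - \sum_(i < n) b i.
pose H (s : R) := expR ((u n - q) * s) - (\sum_(i < n) b i * expR ((u n - u i) * s) + bn).
pose F (s : R) := expR (- q * s) - \sum_(i < n) a i * expR (- u i * s).
have HD s : is_derive s (1 : R) H ((u n - q) * (expR (u n * s) * F s)).
  have -> : (u n - q) * (expR (u n * s) * F s) =
      (u n - q) * expR ((u n - q) * s)
      - (\sum_(i < n) b i * ((u n - u i) * expR ((u n - u i) * s)) + 0).
    have -> : expR ((u n - q) * s) = expR (u n * s) * expR (- q * s).
      by rewrite -expRD -mulrDl.
    rewrite addr0 /F mulrBr mulrBr; congr (_ - _).
    rewrite !mulr_sumr; apply: eq_bigr => i _.
    have ne : u n - u i != 0.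
      rewrite subr_eq0; apply/eqP => /uI ni.
      by have := ltn_ord i; rewrite -ni ltnn.
    have -> : expR ((u n - u i) * s) = expR (u n * s) * expR (- u i * s).
      by rewrite -expRD -mulrDl.
    rewrite /b; move: ne; move: (expR (u n * s)) (expR (- u i * s)) => x y ne.
    by field.
  apply: (@is_deriveB R R^o R^o).
    exact: is_derive_expR_scaled.
  apply: (@is_deriveD R R^o R^o).
    exact: (is_derive_exp_sum n b (fun i => u n - u i)).
have H0 : H 0 = 0.
  rewrite /H mulr0 expR0 (eq_bigr (fun i : 'I_n => b i)) /bn; last first.
    by move=> i _; rewrite mulr0 expR0 mulr1.
  by rewrite addrCA subrr addr0 subrr.
pose K := M * `|1 - q / u n|.
have Ku : K * u n = M * `|u n - q|.
  rewrite /K -mulrA; congr (_ * _); rewrite -[X in _ * X]gtr0_norm// -normrM.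
  by rewrite mulrBl mul1r divfK// gt_eqF.
(* Monotonicity replaces the integral: since [|F| <= M], the derivative
   [(M |u n - q| + e (u n - q) F) e^(u_n s)] is nonnegative, and the value at 0 is [K >= 0]. The
   signs [e = 1] and [e = -1] together bound [|H|]. *)
have bound (e : R) : `|e| = 1 -> forall s, 0 <= s -> 0 <= K * expR (u n * s) + e * H s.
  move=> e1 s s0.
  have := @ndecr_ge0 R (fun v => K * expR (u n * v) + e * H v)
    (fun v => K * (u n * expR (u n * v)) + e * ((u n - q) * (expR (u n * v) * F v))).
  have D v : is_derive v (1 : R) (fun v => K * expR (u n * v) + e * H v)
    (K * (u n * expR (u n * v)) + e * ((u n - q) * (expR (u n * v) * F v))).
    apply: (@is_deriveD R R^o R^o).
      exact: (@is_deriveZ R R^o R^o _ K v 1 _ (is_derive_expR_scaled (u n) v)).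
  move=> /(_ D) P.
  have /P/(_ s s0) : forall v, 0 <= v ->
      0 <= K * (u n * expR (u n * v)) + e * ((u n - q) * (expR (u n * v) * F v)).
    move=> v v0; rewrite (mulrA K) Ku.
    have -> : M * `|u n - q| * expR (u n * v) + e * ((u n - q) * (expR (u n * v) * F v))
      = (M * `|u n - q| + e * (u n - q) * F v) * expR (u n * v) by ring.
    rewrite mulr_ge0 ?expR_ge0// -lerBlDr sub0r.
    rewrite (le_trans (ler_norm _))// normrN !normrM e1 mul1r mulrC ler_wpM2r//.
    exact: IH.
  rewrite H0 mulr0 expR0 mulr1 mulr0 addr0; apply: le_trans.
  by rewrite /K mulr_ge0.
exists (fun i => if i == n then bn else b i) => s s0.
rewrite !big_ord_recr/= eqxx -/M -/K.
rewrite (eq_bigr (fun i : 'I_n => b i * expR (- u i * s))); last first.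
  by move=> i _; rewrite ltn_eqF.
rewrite -(ler_pM2l (expR_gt0 (u n * s))) -{1}[expR (u n * s)]gtr0_norm ?expR_gt0//.
rewrite -normrM (_ : expR (u n * s) * _ = H s); last first.
  rewrite /H mulrBr -expRD -mulrDl; congr (_ - _); rewrite mulrDr; congr (_ + _).
    rewrite mulr_sumr; apply: eq_bigr => i _.
    by rewrite mulrCA -expRD -mulrDl.
  by rewrite mulrCA -expRD mulNr subrr expR0 mulr1.
rewrite ler_norml; apply/andP; split.
  by have := bound 1 (normr1 R) s s0; rewrite mul1r addrC (mulrC K) -lerBlDr sub0r.
by have := bound (-1) (normrN1 R) s s0; rewrite mulN1r subr_ge0 mulrC.
Qed.

(** The substitution [s = - ln l] covers [0 < l <= 1]; at [l = 0] every power vanishes, all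
    exponents being positive. *)
Lemma muntz {R : realType} (u : nat -> R) (q : R) (n : nat) :
  (forall i, 0 < u i) -> injective u -> 0 < q ->
  exists a : nat -> R, forall l, 0 <= l <= 1 ->
    `|l `^ q - \sum_(i < n) a i * l `^ u i| <= \prod_(i < n) `|1 - q / u i|.
Proof.
move=> u0 uI q0; have [a ha] := @muntz_exp R u q n u0 uI q0.
exists a => l /andP[]; rewrite le_eqVlt => /orP[/eqP<- _|l0 l1].
  rewrite powR0 ?gt_eqF// big1 ?subr0 ?normr0 ?prodr_ge0// => i _.
  by rewrite powR0 ?mulr0// gt_eqF.
have := ha (- ln l); rewrite oppr_ge0 ln_le0// => /(_ isT).
by under eq_bigr do rewrite mulrNN; rewrite mulrNN /powR gt_eqF.
Qed.

(** The bound [u i <= c (i + 1)] makes [1 / u i] non-summable, and the divergence of [u] confines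
    the factors that may exceed 1 to the first [n0]. *)
Lemma prod_one_minus_cvg0 {R : realType} (u : nat -> R) (q c : R) :
  (forall i, 0 < u i) -> 0 < c -> (forall i, u i <= c * i.+1%:R) ->
  (forall B, exists n0, forall i, (n0 <= i)%N -> B <= u i) -> 0 < q ->
  forall e, 0 < e -> exists n, \prod_(i < n) `|1 - q / u i| <= e.
Proof.
move=> u0 c0 uc uinf q0 e e0.
have [n0 hn0] := uinf q.
set P := \prod_(i < n0) `|1 - q / u i|.
have P0 : 0 <= P by apply: prodr_ge0.
(* [1 - x <= e^(-x)] reduces the claim to the divergence of the harmonic series *)
have E m : \prod_(i < n0 + m) `|1 - q / u i| <=
    P * expR (- (q / c) * \sum_(i < m) (n0 + i).+1%:R^-1).
  rewrite big_split_ord/= ler_wpM2l// mulr_sumr expR_sum.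
  apply: ler_prod => i _; rewrite normr_ge0/=.
  have ui : q / u (n0 + i)%N <= 1 by rewrite ler_pdivrMr// mul1r hn0// leq_addr.
  rewrite ger0_norm ?subr_ge0//.
  apply: le_trans (expR_ge1Dx _) _.
  rewrite ler_expR mulNr lerN2 -mulrA (ler_wpM2l (ltW q0))// -invfM.
  by rewrite lef_pV2 ?posrE ?mulr_gt0.
(* This threshold makes the exponential at most [1 / (P / e + 1)], hence the product at most
   [P e / (P + e) <= e]; the [+ 1] keeps the argument of [ln] positive when [P = 0]. *)
have [m hm] : exists m, ln (P / e + 1) * (c / q) <= \sum_(i < m) (n0 + i).+1%:R^-1 :> R.
  apply: contrapT => /forallNP H.
  apply: (@dvg_harmonic R).
  apply: (@nondecreasing_is_cvgn R).
    apply: nondecreasing_series => i _ _; exact: harmonic_ge0.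
  exists (\sum_(i < n0) i.+1%:R^-1 + ln (P / e + 1) * (c / q)) => _ [m _ <-].
  rewrite /series/= big_mkord.
  apply: (@le_trans _ _ (\sum_(i < n0 + m) i.+1%:R^-1)).
    rewrite [leRHS](_ : _ = \sum_(0 <= i < n0 + m) i.+1%:R^-1); last by rewrite big_mkord.
    by rewrite (@big_cat_nat _ _ _ m)/= ?leq_addl// big_mkord lerDl sumr_ge0.
  rewrite big_split_ord/= lerD2l.
  by have /negP := H m; rewrite -ltNge => /ltW.
exists (n0 + m)%N; apply: le_trans (E m) _.
have Pe0 : 0 < P / e + 1 by rewrite ltr_wpDl// divr_ge0// ltW.
have : expR (- (q / c) * \sum_(i < m) (n0 + i).+1%:R^-1) <= (P / e + 1)^-1.
  rewrite -[leRHS]lnK ?posrE ?invr_gt0// ler_expR lnV ?posrE//.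
  rewrite mulNr lerN2 -ler_pdivrMl ?divr_gt0// invf_div mulrC//.
move=> /(ler_wpM2l P0)/le_trans; apply.
rewrite ler_pdivrMr// mulrDr mulr1 mulrCA divff ?gt_eqF// mulr1 lerDl ltW//.
Qed.

(** * The gap function Q *)

Lemma expR_diff_le {R : realType} (u v m s : R) :
  0 <= s -> m <= u -> m <= v ->
  `|expR (- (u * s)) - expR (- (v * s))| <= `|u - v| * s * expR (- (m * s)).
Proof.
move=> s0; wlog uv : u v / u <= v.
  move=> W mu mv; have [/W|/ltW/W] := leP u v; first exact.
  by rewrite distrC (distrC u); apply.
move=> mu _; rewrite ger0_norm ?subr_ge0 ?ler_expR ?lerN2 ?ler_wpM2r//.
rewrite distrC ger0_norm ?subr_ge0//.
have -> : expR (- (v * s)) = expR (- (u * s)) * expR (- ((v - u) * s)).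
  by rewrite -expRD; congr expR; ring.
rewrite -[X in X - _]mulr1 -mulrBr mulrC.
have H1 := expR_ge1Dx (- ((v - u) * s)).
apply: (@le_trans _ _ ((v - u) * s * expR (- (u * s)))).
  by rewrite ler_wpM2r ?expR_ge0//; lra.
by rewrite ler_wpM2l ?mulr_ge0 ?subr_ge0// ler_expR lerN2 ler_wpM2r.
Qed.

Lemma expR_diff_le1 {R : realType} (u v m s : R) :
  0 <= s -> m <= u -> m <= v ->
  `|expR (- (u * s)) - expR (- (v * s))| <= expR (- (m * s)).
Proof.
move=> s0 mu mv.
have hu : expR (- (u * s)) <= expR (- (m * s)) by rewrite ler_expR lerN2 ler_wpM2r.
have hv : expR (- (v * s)) <= expR (- (m * s)) by rewrite ler_expR lerN2 ler_wpM2r.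
have := expR_ge0 (- (u * s)); have := expR_ge0 (- (v * s)).
by rewrite ler_norml => ? ?; apply/andP; split; lra.
Qed.

(** Abel summation: as the weights [x ^+ k] do not increase, induction keeps the weighted sum up to
    index [n] above [x ^+ n] times the plain one. *)
Lemma weighted_sum_ge0 {R : realType} (z : nat -> R) (x : R) :
  0 <= x <= 1 -> (forall n, 0 <= \sum_(k < n) z k) ->
  forall n, 0 <= \sum_(k < n) z k * x ^+ k.
Proof.
move=> /andP[x0 x1] z0 [|n]; first by rewrite big_ord0.
apply: (@le_trans _ _ (x ^+ n * \sum_(k < n.+1) z k)).
  by rewrite mulr_ge0 ?exprn_ge0.
elim: n => [|n IH]; first by rewrite !big_ord_recr !big_ord0/= !add0r mulrC.
rewrite big_ord_recr/= [leRHS]big_ord_recr/= mulrDr (mulrC _ (z n.+1)) lerD2r.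
apply: le_trans IH; rewrite exprS -mulrA ler_piMl ?mulr_ge0 ?exprn_ge0 ?z0 ?sumr_ge0//.
Qed.

Lemma sum_geom_le {R : realType} (x : R) (n : nat) : 0 <= x ->
  (1 - x) * \sum_(k < n) x ^+ k <= 1.
Proof.
move=> x0.
have -> : (1 - x) * \sum_(k < n) x ^+ k = 1 - x ^+ n.
  elim: n => [|n IH]; first by rewrite big_ord0 mulr0 expr0 subrr.
  by rewrite big_ord_recr/= mulrDr IH exprS; ring.
by rewrite lerBlDr lerDl exprn_ge0.
Qed.

Lemma sum_nat_geom_le {R : realType} (x : R) (n : nat) : 0 <= x <= 1 ->
  (1 - x) ^+ 2 * \sum_(k < n) k%:R * x ^+ k <= 1.
Proof.
move=> /andP[x0 x1].
have -> : (1 - x) ^+ 2 * \sum_(k < n) k%:R * x ^+ k =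
    x - x ^+ n * (n%:R * (1 - x) + x).
  elim: n => [|n IH]; first by rewrite big_ord0 mulr0 expr0; ring.
  by rewrite big_ord_recr/= mulrDr IH (exprS x n) -(natr1 n); ring.
have : 0 <= x ^+ n * (n%:R * (1 - x) + x).
  by rewrite mulr_ge0 ?exprn_ge0// addr_ge0// mulr_ge0// subr_ge0.
lra.
Qed.

(** The explicit sequence [w] has partial sums [C + e K (K + 1)], which dominate those of [d]; Abel
    summation applied to [w - d] leaves only the series of [k x^k] to bound. *)
Lemma abel_quadratic {R : realType} (d : nat -> R) (C e x : R) :
  0 <= C -> 0 <= e -> 0 <= x < 1 ->
  (forall K, \sum_(k < K.+1) d k <= C + e * K%:R ^+ 2) ->
  forall n, \sum_(k < n) d k * x ^+ k <= C + 2 * e / (1 - x) ^+ 2.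
Proof.
move=> C0 e0 /andP[x0 x1] dK n.
pose w (k : nat) := C * (k == 0)%:R + 2 * e * k%:R.
have wE K : \sum_(k < K.+1) w k = C + e * (K%:R * (K%:R + 1)).
  elim: K => [|K IH]; first by rewrite big_ord_recr big_ord0 /w/=; ring.
  by rewrite big_ord_recr/= IH /w/= -natr1; ring.
have := @weighted_sum_ge0 R (fun k => w k - d k) x _ _ n.
rewrite x0 ltW// => /(_ isT) H.
have : 0 <= \sum_(k < n) (w k - d k) * x ^+ k.
  apply: H => -[|K]; first by rewrite big_ord0.
  rewrite sumrB subr_ge0 (le_trans (dK K))// wE lerD2l ler_wpM2l//.
  by rewrite mulrDr mulr1 lerDl.
under eq_bigr do rewrite mulrBl.
rewrite sumrB subr_ge0 => /le_trans; apply.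
have S0 : \sum_(k < n) C * (k == 0 :> nat)%:R * x ^+ k <= C.
  case: n {H} => [|n]; first by rewrite big_ord0.
  by rewrite big_ord_recl/= big1 ?addr0 ?mulr1// => i _; rewrite mulr0 mul0r.
rewrite [leLHS](_ : _ = \sum_(k < n) C * (k == 0 :> nat)%:R * x ^+ k +
    2 * e * \sum_(k < n) k%:R * x ^+ k); last first.
  rewrite mulr_sumr -big_split/=; apply: eq_bigr => k _; rewrite /w; ring.
have q0 : 0 < (1 - x) ^+ 2 by rewrite exprn_gt0// subr_gt0.
rewrite lerD// ler_pdivlMr// -[leLHS]mulrA -[leRHS]mulr1 ler_wpM2l ?mulr_ge0//.
by rewrite mulrC sum_nat_geom_le// x0 ltW.
Qed.

Lemma ln_bounds {R : realType} (l : R) : 0 < l -> 1 - l <= - ln l /\ l * - ln l <= 1 - l.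
Proof.
move=> l0.
have := expR_ge1Dx (ln l); rewrite lnK ?posrE// => h1.
have := expR_ge1Dx (- ln l); rewrite expRN lnK ?posrE// => h2.
have h3 : l * (1 + - ln l) <= l * l^-1 by rewrite ler_wpM2l// ltW.
rewrite divff ?gt_eqF// in h3.
by split; lra.
Qed.

Section Q_bound.
Context {R : realType} (t : nat -> R) (N : nat) (c : R).
Hypotheses (c0 : 0 < c) (t0 : t 0%N = 0).
Hypotheses (tc : forall k, c * k%:R <= t k) (cN : c <= N%:R).
Hypothesis dK : forall e, 0 < e -> exists2 C, 0 <= C &
  forall K, \sum_(k < K.+1) `|t k - (N * k)%:R| ^+ 2 <= C + e * K%:R ^+ 2.

Let g (l : R) k := l `^ t k - l ^+ (N * k).

Let gE l k : 0 < l ->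
  g l k = expR (- (t k * - ln l)) - expR (- ((N * k)%:R * - ln l)).
Proof.
move=> l0; rewrite /g -powR_mulrn ?ltW// /powR gt_eqF//.
by rewrite !mulrN !opprK.
Qed.

Let ckN k : c * k%:R <= (N * k)%:R.
Proof. by rewrite natrM ler_wpM2r. Qed.

(** Origin of the geometric ratio [e^(-2 c s)], [s = - ln l]: both exponents are at least [c k],
    which yields a factor [e^(-c k s)], and the gap enters squared. *)
Let xkE l k : expR (- (2 * c * - ln l)) ^+ k = expR (- (c * k%:R * - ln l)) ^+ 2.
Proof. by rewrite -!expRM_natr; congr expR; ring. Qed.

Let x_lt1 s : 0 < s -> 2 * c * s <= (1 + 2 * c * s) * (1 - expR (- (2 * c * s))).
Proof.
move=> s0.
have h := expR_ge1Dx (2 * c * s).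
have h2 := expR_gt0 (- (2 * c * s)).
have : (1 + 2 * c * s) * expR (- (2 * c * s)) <= 1.
  by rewrite expRN ler_pdivrMr ?expR_gt0// mul1r.
lra.
Qed.

(** The k-th gap is at most [|t k - N k| s e^(-c k s)], so Abel summation bounds the sum by
    [s^2 (C + 2 e' / (1 - x)^2)] with [e' = e / (2 L^2)]. Then [s <= L (1 - x)] reduces the second
    term to [e], and [s <= 2 (1 - l)] the first to [4 C (1 - l)^2]. *)
Let gap_near1 (e : R) : 0 < e -> exists2 C, 0 <= C &
  forall l, 2^-1 <= l < 1 -> forall n, \sum_(k < n) g l k ^+ 2 <= e + C * (1 - l) ^+ 2.
Proof.
move=> e0.
pose L := (1 + 2 * c) / (2 * c).
have L0 : 0 < L by rewrite divr_gt0 ?addr_gt0 ?mulr_gt0.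
have [|C C0 hC] := @dK (e / (2 * L ^+ 2)).
  by rewrite divr_gt0// mulr_gt0// exprn_gt0.
exists (4 * C); first by rewrite mulr_ge0.
move=> l /andP[l2 l1] n.
have l0 : 0 < l by lra.
have [] := ln_bounds l l0; set s := - ln l => s1 s2.
have s0 : 0 < s by lra.
have s3 : s <= 2 * (1 - l) by nra.
have s4 : s <= 1 by lra.
set x := expR (- (2 * c * s)).
have cs0 : 0 < c * s by rewrite mulr_gt0.
have xs := x_lt1 s s0; rewrite -/x in xs.
have x1 : 0 < 1 - x.
  rewrite subr_gt0 -expR0 ltr_expR oppr_lt0; nra.
have x0 : 0 <= x by exact: expR_ge0.
have sx : s <= L * (1 - x).
  rewrite /L mulrAC ler_pdivlMr ?mulr_gt0//.
  suff : c * s <= c by nra.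
  by rewrite ler_piMr// ltW.
apply: (@le_trans _ _ (s ^+ 2 * \sum_(k < n) `|t k - (N * k)%:R| ^+ 2 * x ^+ k)).
  rewrite mulr_sumr ler_sum// => k _.
  rewrite xkE -/s -real_normK ?num_real// gE// -/s.
  rewrite -exprMn -exprMn ler_pXn2r ?nnegrE ?mulr_ge0 ?expR_ge0 ?normr_ge0 ?(ltW s0)//.
  rewrite mulrA (mulrC s); apply: expR_diff_le; [exact: ltW|exact: tc|exact: ckN].
have := @abel_quadratic R (fun k => `|t k - (N * k)%:R| ^+ 2) C _ x C0 _ _ hC n.
move=> /(_ (ltW _)) H.
have {}H := H (divr_gt0 e0 (mulr_gt0 (ltr0n R 2) (exprn_gt0 2 L0))).
have {}H := ler_wpM2l (sqr_ge0 s) (H _).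
apply: le_trans (H _) _; first by rewrite x0/=; lra.
rewrite mulrDr addrC; apply: lerD.
  rewrite [leLHS]mulrA ler_pdivrMr ?exprn_gt0//.
  have -> : s ^+ 2 * (2 * (e / (2 * L ^+ 2))) = e * (s ^+ 2 / L ^+ 2).
    by have := gt_eqF L0; move=> /negbT Ln0; field.
  rewrite ler_wpM2l ?(ltW e0)// ler_pdivrMr ?exprn_gt0//.
  by rewrite -exprMn (mulrC _ L) ler_pXn2r ?nnegrE ?(ltW s0) ?(mulr_ge0 (ltW L0) (ltW x1)).
have : s ^+ 2 <= (2 * (1 - l)) ^+ 2 by rewrite ler_pXn2r ?nnegrE//; lra.
rewrite exprMn; nra.
Qed.

(** Here boundedness is enough: [l <= 1/2] gives [s >= 1/2], so the ratio [x] stays away from 1 and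
    the geometric series is at most [(1 + c) / c]. *)
Let gap_away l n : 0 <= l <= 2^-1 -> \sum_(k < n) g l k ^+ 2 <= (1 + c) / c.
Proof.
have c1 := c0.
have B0 : 0 <= (1 + c) / c by rewrite divr_ge0 ?addr_ge0 ?(ltW c0).
move=> /andP[]; rewrite le_eqVlt => /orP[/eqP<- _|l0 l2].
  (* At [l = 0] the term [k = 0] is [1 - 1], because [t 0 = 0] and both zeroth powers of 0 are 1;
     for [k > 0] both powers vanish, [N] being nonzero. *)
  rewrite big1// => k _; rewrite /g.
  have [->|k0] := eqVneq (k : nat) 0%N.
    by rewrite t0 muln0 expr0 powRr0 subrr expr0n.
  have := tc k; have : 0 < c * k%:R by rewrite mulr_gt0// ltr0n lt0n.
  move=> ck tk; rewrite powR0 ?gt_eqF ?(lt_le_trans ck)//.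
  rewrite expr0n muln_eq0 (negbTE k0) orbF.
  case: eqP => [N0|_]; last by rewrite subrr expr0n.
  by have := lt_le_trans c0 cN; rewrite N0 ltxx.
have [] := ln_bounds l l0; set s := - ln l => s1 _.
have s0 : 0 < s by lra.
have xs := x_lt1 s s0; set x := expR _ in xs.
have x0 : 0 <= x by exact: expR_ge0.
have cs : c <= 2 * c * s by nra.
have x1 : 0 < 1 - x.
  rewrite subr_gt0 -expR0 ltr_expR oppr_lt0; lra.
have x2 : c <= (1 + c) * (1 - x).
  have : (2 * c * s - c) * (1 - x) <= 2 * c * s - c.
    by rewrite ler_piMr ?subr_ge0//; lra.
  lra.
apply: (@le_trans _ _ (\sum_(k < n) x ^+ k)).
  apply: ler_sum => k _; rewrite xkE -/s -real_normK ?num_real// gE// -/s.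
  rewrite ler_pXn2r ?nnegrE ?expR_ge0//.
  by apply: expR_diff_le1; [exact: ltW|exact: tc|exact: ckN].
rewrite ler_pdivlMr//.
have := @sum_geom_le R x n x0.
have : 0 <= \sum_(k < n) x ^+ k by apply: sumr_ge0 => k _; rewrite exprn_ge0.
nra.
Qed.

Lemma power_gap_bound (e : R) : 0 < e -> exists2 C, 0 <= C &
  forall l, 0 <= l <= 1 -> forall n,
    \sum_(k < n) (l `^ t k - l ^+ (N * k)) ^+ 2 <= e + C * (1 - l) ^+ 2.
Proof.
move=> e0; have [C C0 hC] := gap_near1 e e0.
have c1 := c0.
set B := (1 + c) / c.
have B0 : 0 <= B by rewrite divr_ge0 ?addr_ge0 ?(ltW c0).
(* The part [4 * B] pays for [l <= 1/2], where [4 (1 - l)^2 >= 1]. *)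
exists (C + 4 * B); first by nra.
move=> l /andP[l0 l1] n.
have sq0 : 0 <= (1 - l) ^+ 2 by exact: sqr_ge0.
have [->|ln1] := eqVneq l 1.
  rewrite big1 ?subrr; last by move=> k _; rewrite powR1 expr1n subrr expr0n.
  by rewrite expr0n mulr0; lra.
have [l2|/ltW l2] := leP 2^-1 l.
  apply: le_trans (hC l _ n) _; first by rewrite l2 lt_neqAle ln1 l1.
  nra.
apply: le_trans (gap_away l n _) _; first by rewrite l0.
have : 1 <= 4 * (1 - l) ^+ 2 by rewrite expr2; nra.
rewrite -/B; nra.
Qed.

End Q_bound.

(** * Norms, inner products and polynomials in an operator *)

Local Open Scope complex_scope.

Section rnorm_theory.
Context {R : realType} {V : normedModType R[i]}.
Implicit Types x y : V.

Lemma rnormE x : `|x| = (rnorm x)%:C.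
Proof. by rewrite /rnorm RRe_real// normr_real. Qed.

Lemma rnorm_ge0 x : 0 <= rnorm x.
Proof. by rewrite -ler0c -rnormE. Qed.

Lemma rnorm0 : rnorm (0 : V) = 0.
Proof. by rewrite /rnorm normr0. Qed.

Lemma rnormD x y : rnorm (x + y) <= rnorm x + rnorm y.
Proof. by rewrite -lecR rmorphD/= -!rnormE ler_normD. Qed.

Lemma rnormN x : rnorm (- x) = rnorm x.
Proof. by rewrite /rnorm normrN. Qed.

Lemma rnormB x y : rnorm (x - y) <= rnorm x + rnorm y.
Proof. by rewrite (le_trans (rnormD _ _))// rnormN. Qed.

Lemma rnorm_distC x y : rnorm (x - y) = rnorm (y - x).
Proof. by rewrite -rnormN opprB. Qed.

Lemma rnormZ (z : R[i]) x : rnorm (z *: x) = complex.Re `|z| * rnorm x.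
Proof.
have [k zk] : exists k : R, `|z| = k%:C by apply/complex_realP; exact: normr_real.
by rewrite {1}/rnorm normrZ zk rnormE -rmorphM.
Qed.

Lemma rnormZr (a : R) x : rnorm (a%:C *: x) = `|a| * rnorm x.
Proof. by rewrite rnormZ normc_def/= expr0n/= addr0 sqrtr_sqr. Qed.

Lemma rnorm_eq0 x : rnorm x = 0 -> x = 0.
Proof. by move=> x0; apply/eqP; rewrite -normr_eq0 rnormE x0. Qed.

Lemma rnorm_sqrD x y : rnorm (x + y) ^+ 2 <= 2 * rnorm x ^+ 2 + 2 * rnorm y ^+ 2.
Proof.
apply: (@le_trans _ _ ((rnorm x + rnorm y) ^+ 2)).
  by rewrite ler_pXn2r ?nnegrE ?addr_ge0 ?rnorm_ge0// rnormD.
have := sqr_ge0 (rnorm x - rnorm y); nra.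
Qed.

End rnorm_theory.

(** The real part is a real inner product with the same norm, so that all estimates on quadratic
    forms take place in [R]. *)
Definition ip {R : realType} {H : completeNormedModType R[i]}
  (dot : {dot H for Num.conj}) (x y : H) : R := complex.Re (dot x y).

Lemma Re_conj {R : realType} (z : R[i]) : complex.Re (Num.conj z) = complex.Re z.
Proof. by case: z. Qed.

Lemma ReD {R : realType} (z w : R[i]) : complex.Re (z + w) = complex.Re z + complex.Re w.
Proof. by case: z w => a b []. Qed.

Lemma ReZ {R : realType} (a : R) (z : R[i]) : complex.Re (a%:C * z) = a * complex.Re z.
Proof. by case: z => u v /=; rewrite mul0r subr0. Qed.

Section ip_theory.
Context {R : realType} {H : completeNormedModType R[i]}.
Context (dot : {dot H for Num.conj}).
Implicit Types x y z : H.
Local Notation "'<< x , y >>" := (ip dot x y).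

Lemma ipC x y : '<<x, y>> = '<<y, x>>.
Proof. by rewrite /ip (hermC dot x y) expr0 mul1r; exact: Re_conj. Qed.

Lemma ipDl x y z : '<<x + y, z>> = '<<x, z>> + '<<y, z>>.
Proof. by rewrite /ip linearDl ReD. Qed.

Lemma ipZl (a : R) x z : '<<a%:C *: x, z>> = a * '<<x, z>>.
Proof. by rewrite /ip linearZl_LR; exact: ReZ. Qed.

Lemma ipDr x y z : '<<z, x + y>> = '<<z, x>> + '<<z, y>>.
Proof. by rewrite ipC ipDl !(ipC z). Qed.

Lemma ipZr (a : R) x z : '<<z, a%:C *: x>> = a * '<<z, x>>.
Proof. by rewrite ipC ipZl (ipC z). Qed.

Lemma ipNl x z : '<<- x, z>> = - '<<x, z>>.
Proof. by rewrite -scaleN1r -[-1 in LHS](rmorphN1 (real_complex R)) ipZl mulN1r. Qed.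

Lemma ipNr x z : '<<z, - x>> = - '<<z, x>>.
Proof. by rewrite ipC ipNl (ipC z). Qed.

(** Multiplication by ['i] is skew for the real inner product; against symmetric operators this
    makes the cross terms vanish. *)
Lemma ip_iz (x y : H) : '<<x, 'i%C *: y>> = - '<<'i%C *: x, y>>.
Proof.
rewrite ipC /ip !linearZl_LR/= (hermC dot y x) expr0 mul1r.
have E (z : R[i]) : complex.Re ('i%C * Num.conj z) = - complex.Re ('i%C * z).
  by case: z => a b /=; rewrite !mul0r !mul1r !sub0r.
exact: E.
Qed.

Definition ipE := (ipDl, ipDr, ipNl, ipNr, ipZl, ipZr).

Hypothesis hd : hilbert_dot dot.

Lemma rnorm_sqr x : rnorm x ^+ 2 = '<<x, x>>.
Proof. by rewrite /ip -(hd x) rnormE -rmorphXn. Qed.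

Lemma ip_ge0 x : 0 <= '<<x, x>>.
Proof. by rewrite -rnorm_sqr sqr_ge0. Qed.

Lemma ip_young (c : R) x y : 0 < c -> 2 * '<<x, y>> <= c * '<<x, x>> + c^-1 * '<<y, y>>.
Proof.
move=> c0; have := ip_ge0 (c%:C *: x - y).
rewrite !ipE (ipC y x) => h.
have : 0 <= c^-1 * (c * (c * '<<x, x>>) - c * '<<x, y>> - (c * '<<x, y>> - '<<y, y>>)).
  by rewrite mulr_ge0 ?invr_ge0 ?(ltW c0)//; apply: le_trans h _; lra.
have cc : c^-1 * c = 1 by rewrite mulVf ?gt_eqF.
rewrite !mulrBr !mulrA cc !mul1r; lra.
Qed.

End ip_theory.

Lemma lin_scale {R : realType} {U V : normedModType R[i]} (C : {linear U -> V})
  (z : R[i]) x : C (z *: x) = z *: C x.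
Proof. by rewrite -[z *: x]addr0 linearP raddf0 addr0. Qed.

Section poly_op_theory.
Context {R : realType} {H : completeNormedModType R[i]}.
Variable A : {linear H -> H}.
Implicit Types (p q : {poly R[i]}) (x y : H).

Lemma iter_linear n (z : R[i]) x y :
  iter n A (z *: x + y) = z *: iter n A x + iter n A y.
Proof. by elim: n => //= n ->; rewrite linearP. Qed.

Lemma poly_op_widen n p x : (size p <= n)%N ->
  poly_op p A x = \sum_(i < n) p`_i *: iter i A x.
Proof.
move=> pn; rewrite /poly_op (big_ord_widen n (fun i => p`_i *: iter i A x) pn).
rewrite big_mkcond; apply: eq_bigr => i _; case: ltnP => // h.
by rewrite nth_default// scale0r.
Qed.

Lemma poly_op_linear p (z : R[i]) x y :
  poly_op p A (z *: x + y) = z *: poly_op p A x + poly_op p A y.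
Proof.
rewrite /poly_op scaler_sumr -big_split; apply: eq_bigr => i _ /=.
by rewrite iter_linear scalerDr !scalerA mulrC.
Qed.

Lemma poly_opD p q x : poly_op (p + q) A x = poly_op p A x + poly_op q A x.
Proof.
pose n := maxn (size p) (size q).
rewrite !(@poly_op_widen n) ?leq_maxl ?leq_maxr ?size_polyD// -big_split/=.
by apply: eq_bigr => i _; rewrite coefD scalerDl.
Qed.

Lemma poly_opZ (c : R[i]) p x : poly_op (c *: p) A x = c *: poly_op p A x.
Proof.
rewrite (@poly_op_widen (size p)) ?size_scale_leq// /poly_op scaler_sumr.
by apply: eq_bigr => i _; rewrite coefZ scalerA.
Qed.

Lemma poly_opC (c : R[i]) x : poly_op c%:P A x = c *: x.
Proof.
by rewrite (@poly_op_widen 1%N) ?size_polyC ?leq_b1// big_ord1 coefC.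
Qed.

Lemma poly_op_mulX p x : poly_op (p * 'X) A x = poly_op p A (A x).
Proof.
rewrite (@poly_op_widen (size p).+1); last first.
  by rewrite (leq_trans (size_polyMleq _ _))// size_polyX addn2.
rewrite big_ord_recl coefMX/= scale0r add0r /poly_op.
by apply: eq_bigr => i _; rewrite coefMX/= -iterS iterSr.
Qed.

Lemma poly_opX x : poly_op 'X A x = A x.
Proof. by rewrite -['X]mul1r poly_op_mulX poly_opC scale1r. Qed.

Lemma poly_op_comm p x : poly_op p A (A x) = A (poly_op p A x).
Proof.
rewrite /poly_op raddf_sum; apply: eq_bigr => i _.
by rewrite -iterSr; exact/esym/lin_scale.
Qed.

Lemma poly_opM p q x : poly_op (p * q) A x = poly_op p A (poly_op q A x).
Proof.
elim/poly_ind: p x => [|p c IH] x.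
  by rewrite mul0r /poly_op size_poly0 !big_ord0.
rewrite mulrDl mulrAC !poly_opD !poly_op_mulX IH poly_op_comm.
by rewrite mul_polyC poly_opZ poly_opC.
Qed.

End poly_op_theory.

(* Polynomials with real coefficients act on [H] through the embedding of [R]
   into [R[i]]. *)
Definition rpoly_op {R : realType} {H : completeNormedModType R[i]}
  (p : {poly R}) (A : H -> H) : H -> H := poly_op (map_poly (real_complex R) p) A.

Section rpoly_op_theory.
Context {R : realType} {H : completeNormedModType R[i]}.
Variable A : {linear H -> H}.
Implicit Types (p q : {poly R}) (x y : H).

Lemma rpoly_opD p q x : rpoly_op (p + q) A x = rpoly_op p A x + rpoly_op q A x.
Proof. by rewrite /rpoly_op rmorphD poly_opD. Qed.

Lemma rpoly_opM p q x : rpoly_op (p * q) A x = rpoly_op p A (rpoly_op q A x).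
Proof. by rewrite /rpoly_op rmorphM poly_opM. Qed.

Lemma rpoly_opZ (c : R) p x : rpoly_op (c *: p) A x = c%:C *: rpoly_op p A x.
Proof. by rewrite /rpoly_op map_polyZ poly_opZ. Qed.

Lemma rpoly_opC (c : R) x : rpoly_op c%:P A x = c%:C *: x.
Proof. by rewrite /rpoly_op map_polyC poly_opC. Qed.

Lemma rpoly_opX x : rpoly_op 'X A x = A x.
Proof. by rewrite /rpoly_op map_polyX poly_opX. Qed.

Lemma rpoly_op_linear p (z : R[i]) x y :
  rpoly_op p A (z *: x + y) = z *: rpoly_op p A x + rpoly_op p A y.
Proof. exact: poly_op_linear. Qed.

Lemma rpoly_opN p x : rpoly_op (- p) A x = - rpoly_op p A x.
Proof. by rewrite -scaleN1r rpoly_opZ rmorphN1 scaleN1r. Qed.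

Lemma rpoly_opXn n x : rpoly_op 'X^n A x = iter n A x.
Proof.
elim: n x => [|n IH] x; first by rewrite expr0 rpoly_opC scale1r.
by rewrite exprSr rpoly_opM rpoly_opX IH iterSr.
Qed.

Lemma rpoly_op_sum n (f : nat -> {poly R}) x :
  rpoly_op (\sum_(i < n) f i) A x = \sum_(i < n) rpoly_op (f i) A x.
Proof.
elim: n => [|n IH]; first by rewrite !big_ord0 rpoly_opC scale0r.
by rewrite !big_ord_recr/= rpoly_opD IH.
Qed.

Lemma rpoly_op_sym (dot : {dot H for Num.conj}) p x y :
  (forall x y, ip dot (A x) y = ip dot x (A y)) ->
  ip dot (rpoly_op p A x) y = ip dot x (rpoly_op p A y).
Proof.
move=> sA; elim/poly_ind: p x y => [|p c IH] x y.
  by rewrite !rpoly_opC !scale0r -(scale0r x) -(rmorph0 (real_complex R)) !ipE !mul0r.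
rewrite !rpoly_opD !rpoly_opC !ipE; congr (_ + _).
by rewrite [in RHS]mulrC !rpoly_opM !rpoly_opX IH sA.
Qed.

End rpoly_op_theory.

(** * Neumann series *)

Lemma pos_complexE {R : realType} (e : R[i]) :
  0 < e -> e = (complex.Re e)%:C /\ 0 < complex.Re e.
Proof.
move=> e0; have ee : (complex.Re e)%:C = e by rewrite RRe_real// gtr0_real.
by rewrite -ltcR ee.
Qed.

Section complete_space.
Context {R : realType} {H : completeNormedModType R[i]}.

Lemma rnorm_cauchy_cvg (u : nat -> H) :
  (forall e : R, 0 < e -> exists n0, forall n m, (n0 <= n)%N -> (n0 <= m)%N ->
     rnorm (u n - u m) <= e) ->
  exists l, forall e : R, 0 < e -> exists n0, forall n, (n0 <= n)%N -> rnorm (u n - l) <= e.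
Proof.
move=> uC.
have /cauchy_cvgP uc : cauchy (u @ \oo).
  apply/cauchyP => e /pos_complexE[-> e0].
  have [n0 hn0] := uC (complex.Re e / 2) (divr_gt0 e0 (ltr0n _ 2)).
  exists (u n0); exists n0 => //= m /= nm.
  rewrite -ball_normE/= rnormE ltcR.
  apply: le_lt_trans (hn0 n0 m (leqnn _) nm) _.
  by rewrite ltr_pdivrMr// ltr_pMr// ltrDl.
exists (lim (u @ \oo)) => e e0.
have /cvgrPdist_le/(_ e%:C) := uc.
rewrite ltcR => /(_ e0)[n0 _ hn0]; exists n0 => n nn0.
by have := hn0 n nn0; rewrite rnormE lecR rnorm_distC.
Qed.

Lemma bounded_continuous (B : {linear H -> H}) (M : R) :
  (forall x, rnorm (B x) <= M * rnorm x) -> continuous B.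
Proof.
move=> BM; apply: bounded_linear_continuous; apply/linear_boundedP.
exists M%:C; split; first by apply/complex_realP; exists M.
move=> r Mr x; apply: (@le_trans _ _ (M%:C * `|x|)).
  by rewrite !rnormE -rmorphM lecR.
by rewrite ler_wpM2r// ltW.
Qed.

Lemma continuous_bounded (B : {linear H -> H}) :
  continuous B -> exists2 M : R, 0 < M & forall x, rnorm (B x) <= M * rnorm x.
Proof.
move=> /linear_bounded_continuous/linear_boundedP/pinfty_ex_gt0[M M0 hM].
have [ME M1] := @pos_complexE R M M0.
exists (complex.Re M) => // x.
by rewrite -lecR rmorphM/= -!rnormE; have := hM x; rewrite {1}ME.
Qed.

(** The iteration [w -> w - k V w + k x] is a contraction whose fixed points solve [V w = x]; the
    inverse is bounded since [|y| <= |y - k V y| + |k| |V y|]. The free factor [k] is tuned later to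
    the point of the complex plane to be excluded from the spectrum. *)
Lemma neumann_inverse (V : H -> H) (k : R[i]) (K : R) :
  linear V -> 0 <= K < 1 ->
  (forall u, rnorm (u - k *: V u) <= K * rnorm u) ->
  exists B : {linear H -> H}, [/\ continuous B,
    (forall x, B (V x) = x) & (forall x, V (B x) = x)].
Proof.
move=> linV /andP[K0 K1] VK.
have VD x y : V (x + y) = V x + V y by have := linV 1 x y; rewrite !scale1r.
have V0 : V 0 = 0 by apply: (addrI (V 0)); rewrite -VD !addr0.
have VZ z x : V (z *: x) = z *: V x by have := linV z x 0; rewrite V0 !addr0.
have VN x : V (- x) = - V x by rewrite -scaleN1r VZ scaleN1r.
have inj u : V u = 0 -> u = 0.
  move=> Vu; have := VK u; rewrite Vu scaler0 subr0 => h.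
  apply: rnorm_eq0; have := rnorm_ge0 u; nra.
have injV u v : V u = V v -> u = v.
  move=> uv; apply/eqP; rewrite -subr_eq0; apply/eqP/inj.
  by rewrite VD VN uv subrr.
have bnd y : rnorm y <= complex.Re `|k| / (1 - K) * rnorm (V y).
  have := rnormD (y - k *: V y) (k *: V y); rewrite subrK rnormZ => h.
  have := VK y => h1.
  rewrite mulrAC ler_pdivlMr ?subr_gt0//; lra.
have surj x : exists y, V y = x.
  have [->|x0] := eqVneq x 0; first by exists 0.
  (* With [k = 0] the hypothesis reads [|x| <= K |x|], which forces [x = 0]. *)
  have k0 : k != 0.
    apply/eqP => k0; have := VK x; rewrite k0 scale0r subr0 => h.
    by move/eqP: x0; apply; apply: rnorm_eq0; have := rnorm_ge0 x; nra.
  pose T u := u - k *: V u.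
  have TD u v : T (u + v) = T u + T v.
    by rewrite /T VD scalerDr opprD addrACA.
  have TN u : T (- u) = - T u by rewrite /T VN scalerN opprB opprK addrC.
  pose w n := iter n (fun u => T u + k *: x) 0.
  set c := rnorm (k *: x).
  have wd n : rnorm (w n.+1 - w n) <= K ^+ n * c.
    elim: n => [|n IH].
      by rewrite /w/= /T V0 scaler0 !subr0 add0r expr0 mul1r.
    rewrite [w n.+2]/w iterS -/(w n.+1) {2}/w iterS -/(w n) opprD addrACA subrr addr0.
    rewrite -TN -TD (le_trans (VK _))// exprS -mulrA ler_wpM2l//.
  (* The summed geometric bound on the increments, multiplied by [1 - K] to stay free of
     division. *)
  have wdm n m : rnorm (w (n + m)%N - w n) * (1 - K) <= K ^+ n * c * (1 - K ^+ m).
    elim: m => [|m IH]; first by rewrite addn0 subrr rnorm0 expr0 subrr mulr0 mul0r.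
    rewrite addnS.
    have K10 : 0 <= 1 - K by rewrite subr_ge0 ltW.
    have := ler_wpM2r K10 (rnormD (w (n + m).+1 - w (n + m)%N) (w (n + m)%N - w n)).
    rewrite subrKA => h; have := ler_wpM2r K10 (wd (n + m)%N).
    rewrite exprD exprS; nra.
  have c0 : 0 <= c by exact: rnorm_ge0.
  have [|l hl] := rnorm_cauchy_cvg w.
    move=> e e0.
    have K2 : `|K| < 1 by rewrite ger0_norm.
    have /cvgrPdist_le/(_ (e * (1 - K) / (2 * (c + 1)))) := cvg_expr K2.
    case; first by rewrite !(divr_gt0, mulr_gt0)// ?subr_gt0// ltr_wpDl.
    move=> n0 _ hn0; have := hn0 n0 (leqnn _).
    rewrite sub0r normrN ger0_norm ?exprn_ge0// ler_pdivlMr; last first.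
      by rewrite mulr_gt0// ltr_wpDl.
    move=> hK.
    have half n : (n0 <= n)%N -> rnorm (w n - w n0) <= e / 2.
      move=> nn; rewrite -(subnKC nn); have := wdm n0 (n - n0)%N.
      set r := rnorm _ => h.
      have p1 : 0 <= K ^+ n0 by rewrite exprn_ge0.
      have p2 : 0 <= K ^+ (n - n0) by rewrite exprn_ge0.
      have p3 : K ^+ n0 * c * (1 - K ^+ (n - n0)) <= K ^+ n0 * c.
        by rewrite ler_piMr ?mulr_ge0// lerBlDr lerDl.
      have r1 : r * (1 - K) <= e / 2 * (1 - K) by lra.
      by rewrite ler_pM2r ?subr_gt0 in r1.
    exists n0 => n m nn mm.
    rewrite -(subrKA (w n0)) (le_trans (rnormD _ _))//.
    by rewrite (rnorm_distC (w n0)) (splitr e) lerD// half.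
  exists l.
  have : rnorm (l - (T l + k *: x)) <= 0.
    apply/ler_addgt0Pr => e e0; rewrite add0r.
    have [n0 hn0] := hl (e / 2) (divr_gt0 e0 (ltr0n _ 2)).
    have h1 := hn0 n0.+1 (leqnSn _); have h2 := hn0 n0 (leqnn _).
    have E (p q r : H) : l - (q + r) = l - (p + r) + (p - q).
      by rewrite !opprD !addrA [_ - r + p]addrAC subrK addrAC.
    rewrite (E (T (w n0))) -TN -TD -/(w n0.+1).
    rewrite (le_trans (rnormD _ _))// rnorm_distC (splitr e) lerD//.
    rewrite (le_trans (VK _))// (le_trans _ h2)//.
    by rewrite ler_piMl ?rnorm_ge0// ltW.
  rewrite {1}/T opprD opprB addrA [l + _]addrC subrK -scalerBr => h.
  have /rnorm_eq0/eqP : rnorm (k *: (V l - x)) = 0.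
    by apply/eqP; rewrite eq_le h rnorm_ge0.
  by rewrite scaler_eq0 (negbTE k0) subr_eq0 => /eqP.
have [B BV] := choice surj.
have linB : linear B.
  by move=> z x y; apply: injV; rewrite BV linV !BV.
pose Bl : {linear H -> H} := HB.pack B (GRing.isLinear.Build _ _ _ _ B linB).
exists Bl; split => //.
- apply: (@bounded_continuous Bl (complex.Re `|k| / (1 - K))) => x.
  by rewrite (le_trans (bnd _))//= BV.
- by move=> x; apply: injV; rewrite /= BV.
Qed.

End complete_space.

(** * Spectrum and positivity *)

Definition positive_contraction {R : realType} {H : completeNormedModType R[i]}
    (dot : {dot H for Num.conj}) (A : H -> H) : Prop :=
  [/\ forall x y, ip dot (A x) y = ip dot x (A y),
      forall x, 0 <= ip dot (A x) x
    & forall x, rnorm (A x) <= rnorm x].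

(** This is [S^2 <= M S], obtained without a square root of [S]: expand the positive form of [S] at
    [M x - S x] and bound it at [S x] by [M |S x|^2]. *)
Lemma pos_sym_sqr_le {R : realType} {H : completeNormedModType R[i]}
    (dot : {dot H for Num.conj}) (S : {linear H -> H}) (M : R) :
  hilbert_dot dot -> 0 < M ->
  (forall x y, ip dot (S x) y = ip dot x (S y)) ->
  (forall x, 0 <= ip dot (S x) x) ->
  (forall x, rnorm (S x) <= M * rnorm x) ->
  forall x, rnorm (S x) ^+ 2 <= M * ip dot (S x) x.
Proof.
move=> hd M0 sS pS bS x.
have Sle y : ip dot (S y) y <= M * rnorm y ^+ 2.
  have := @ip_young R H dot hd M^-1 (S y) y; rewrite invr_gt0 => /(_ M0).
  rewrite -!(rnorm_sqr dot hd) invrK.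
  have : M^-1 * rnorm (S y) ^+ 2 <= M * rnorm y ^+ 2.
    rewrite ler_pdivrMl// mulrA -expr2 -exprMn.
    by rewrite ler_pXn2r ?nnegrE ?mulr_ge0 ?rnorm_ge0 ?(ltW M0).
  lra.
have h1 := pS (M%:C *: x - S x).
have h2 := Sle (S x).
rewrite linearB linearZ_LR/= !ipE (sS (S x) x) -(rnorm_sqr dot hd) in h1.
rewrite -(ler_pM2l M0); lra.
Qed.

Section spectral_calculus.
Context {R : realType} {H : completeNormedModType R[i]}.
Context (dot : {dot H for Num.conj}) (hd : hilbert_dot dot).
Context (A : {linear H -> H}) (hA : positive_contraction dot A).
Local Notation "'<< x , y >>" := (ip dot x y).

Let sA x y : '<<A x, y>> = '<<x, A y>>. Proof. by case: hA => + _ _; apply. Qed.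
Let pA x : 0 <= '<<A x, x>>. Proof. by case: hA => _ + _; apply. Qed.
Let nA x : rnorm (A x) <= rnorm x. Proof. by case: hA => _ _; apply. Qed.

Let kA x : rnorm (A x) ^+ 2 <= '<<A x, x>>.
Proof.
rewrite -[leRHS]mul1r; apply: pos_sym_sqr_le => // y.
by rewrite mul1r.
Qed.

Let nA2 x : rnorm (A x) ^+ 2 <= rnorm x ^+ 2.
Proof. by rewrite ler_pXn2r ?nnegrE ?rnorm_ge0. Qed.

Let shift_linear (z : R[i]) : linear (fun x => A x - z *: x).
Proof.
by move=> a x y; rewrite linearP scalerDr opprD addrACA scalerBr !scalerA mulrC.
Qed.

Lemma not_spectrum (z k : R[i]) (K : R) : 0 <= K < 1 ->
  (forall u, rnorm (u - k *: (A u - z *: u)) ^+ 2 <= K * rnorm u ^+ 2) ->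
  ~ spectrum A z.
Proof.
move=> /andP[K0 K1] hK; apply.
apply: (@neumann_inverse R H _ k (Num.sqrt K) (shift_linear z)).
  by rewrite sqrtr_ge0/= -sqrtr1 ltr_sqrt.
move=> u; rewrite -(@ler_pXn2r _ 2) ?nnegrE ?mulr_ge0 ?sqrtr_ge0 ?rnorm_ge0//.
rewrite exprMn sqr_sqrtr //; exact: hK.
Qed.

(** For [z = a + i b] with [b != 0], choose [k = i v]. Then [u - k (A - z) u = (1 - v b) u - i v w]
    with [w = (A - a) u], and [u] is orthogonal to [i w] because [A] is symmetric; Pythagoras gives
    the factor [K]. *)
Lemma spectrum_real (z : R[i]) : spectrum A z -> exists l : R, z = l%:C.
Proof.
case: z => a b; have [->|b0] := eqVneq b 0; first by exists a.
move=> zA; exfalso; move: zA.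
pose M := 2 + 2 * a ^+ 2 : R.
have M0 : 0 < M by rewrite /M; have := sqr_ge0 a; lra.
have b2 : 0 < b ^+ 2 by rewrite exprn_even_gt0.
(* The minimiser of [(1 - v b)^2 + v^2 M], with minimum [M / (b^2 + M) < 1]. *)
pose v := b / (b ^+ 2 + M).
have dn0 : 0 < b ^+ 2 + M by lra.
pose K := (1 - v * b) ^+ 2 + v ^+ 2 * M.
have K0 : 0 <= K by rewrite addr_ge0 ?sqr_ge0// mulr_ge0 ?sqr_ge0// ltW.
have K1 : K < 1.
  have -> : K = 1 - b ^+ 2 / (b ^+ 2 + M).
    by rewrite /K /v; move/gt_eqF/negbT: dn0 => dn0; field.
  by rewrite ltrBlDr ltrDl divr_gt0.
apply: (@not_spectrum _ (v%:C * 'i%C) K); first by rewrite K0.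
move=> u.
set w := A u - a%:C *: u.
have -> : u - (v%:C * 'i%C) *: (A u - (a +i* b) *: u) =
   (1 - v * b)%:C *: u - v%:C *: ('i%C *: w).
  rewrite /w (_ : a +i* b = a%:C + b%:C * 'i%C); last first.
    by apply/eqP; rewrite eq_complex/= !mul0r !mulr0 !mulr1 !add0r subr0 addr0 !eqxx.
  rewrite scalerDl -!scalerA opprD addrA !scalerBr.
  have -> : 'i%C *: (b%:C *: ('i%C *: u)) = - b%:C *: u.
    by rewrite !scalerA mulrC mulrA -expr2 sqr_i mulN1r.
  rewrite opprB addrA; congr (_ - _).
  by rewrite scalerA mulrN -rmorphM rmorphB rmorph1 scalerBl scale1r scaleNr.
have iw0 : '<<u, 'i%C *: w>> = 0.
  have : '<<u, 'i%C *: w>> = - '<<u, 'i%C *: w>>.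
    rewrite {1}ip_iz /w; congr (- _).
    rewrite !(scalerBr, ipE).
    have -> : 'i%C *: (a%:C *: u) = a%:C *: ('i%C *: u) by rewrite !scalerA mulrC.
    by rewrite !ipE -(sA ('i%C *: u)) lin_scale (ipC dot ('i%C *: A u)) (ipC dot ('i%C *: u)).
  lra.
have wM : rnorm w ^+ 2 <= M * rnorm u ^+ 2.
  have := rnorm_sqrD (A u) (- (a%:C *: u)).
  rewrite -/w rnormN rnormZr exprMn real_normK ?num_real//.
  by have := nA2 u; rewrite /M; lra.
rewrite (rnorm_sqr dot hd) !ipE (ipC _ _ u) iw0 -!(rnorm_sqr dot hd).
rewrite rnormZ normc_def/= expr0n expr1n add0r sqrtr1 mul1r /K.
have : v ^+ 2 * rnorm w ^+ 2 <= v ^+ 2 * (M * rnorm u ^+ 2) by rewrite ler_wpM2l ?sqr_ge0.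
lra.
Qed.

(** From [|A u|^2 <= ip (A u) u] follows [|(A - 1/2) u| <= |u| / 2]; outside [0, 1] one has
    [|l - 1/2| > 1/2], and [k = -1 / (l - 1/2)] turns [u - k (A - l) u] into
    [(A - 1/2) u / (l - 1/2)]. *)
Lemma spectrum_unit (l : R) : spectrum A l%:C -> 0 <= l <= 1.
Proof.
move=> lA; apply: contrapT => /negP nl; move: lA.
have l2 : 4^-1 < (l - 2^-1) ^+ 2.
  move: nl; rewrite negb_and -!ltNge => /orP[] ?; nra.
have l0 : l - 2^-1 != 0.
  by apply/eqP => e; move: l2; rewrite e expr0n/= invr_lt0 ltrn0.
pose K := 4^-1 / (l - 2^-1) ^+ 2.
have q0 : 0 < (l - 2^-1) ^+ 2 by rewrite exprn_even_gt0.
apply: (@not_spectrum _ (- (l - 2^-1)^-1)%:C K).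
  by rewrite divr_ge0 ?(ltW q0)//= ltr_pdivrMr// mul1r.
move=> u.
have -> : u - (- (l - 2^-1)^-1)%:C *: (A u - l%:C *: u) =
    ((l - 2^-1)^-1)%:C *: (A u - (2^-1)%:C *: u).
  have E : u = ((l - 2^-1)^-1)%:C *: ((l - 2^-1)%:C *: u).
    by rewrite scalerA -rmorphM mulVf// rmorph1 scale1r.
  rewrite rmorphN scaleNr opprK {1}E -scalerDr; congr (_ *: _).
  by rewrite addrC (rmorphB (real_complex R)) scalerBl subrKA.
rewrite rnormZr exprMn real_normK ?num_real// /K exprVn mulrAC.
rewrite mulrC ler_pM2r ?invr_gt0//.
rewrite [leLHS](rnorm_sqr dot hd) !ipE (ipC _ u (A u)) -!(rnorm_sqr dot hd).
have := kA u; lra.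
Qed.

End spectral_calculus.

Section positive_calculus.
Context {R : realType} {H : completeNormedModType R[i]}.
Context (dot : {dot H for Num.conj}) (hd : hilbert_dot dot).
Context (A : {linear H -> H}) (hA : positive_contraction dot A).
Local Notation "'<< x , y >>" := (ip dot x y).

Let sA x y : '<<A x, y>> = '<<x, A y>>. Proof. by case: hA => + _ _; apply. Qed.
Let pA x : 0 <= '<<A x, x>>. Proof. by case: hA => _ + _; apply. Qed.
Let nA x : rnorm (A x) <= rnorm x. Proof. by case: hA => _ _; apply. Qed.

Lemma rpoly_op_bounded (p : {poly R}) :
  exists2 M : R, 0 < M & forall x, rnorm (rpoly_op p A x) <= M * rnorm x.
Proof.
elim/poly_ind: p => [|p c [M M0 hM]].
  by exists 1 => // x; rewrite rpoly_opC scale0r rnorm0 mul1r rnorm_ge0.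
exists (M + `|c|) => [|x]; first by rewrite ltr_pwDl.
rewrite rpoly_opD rpoly_opM rpoly_opX rpoly_opC (le_trans (rnormD _ _))//.
rewrite rnormZr mulrDl lerD2r (le_trans (hM _))// ler_wpM2l// ltW//.
Qed.

Lemma not_spectrum_bounded_below (z : R[i]) : ~ spectrum A z ->
  exists2 c : R, 0 < c & forall x, c * rnorm x <= rnorm (A x - z *: x).
Proof.
move=> /contrapT[B [/continuous_bounded[M M0 hM] BK _]].
exists M^-1; first by rewrite invr_gt0.
by move=> x; rewrite ler_pdivrMl// -{1}(BK x).
Qed.

(** Over the algebraically closed field [R[i]] the operator factors into a nonzero scalar and
    operators [A - z], each bounded below. *)
Lemma poly_op_bounded_below (p : {poly R[i]}) : p != 0 ->
  (forall z, root p z -> ~ spectrum A z) ->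
  exists2 c : R, 0 < c & forall x, c * rnorm x <= rnorm (poly_op p A x).
Proof.
move=> p0; have [r ->] := closed_field_poly_normal p.
have lc0 : lead_coef p != 0 by rewrite lead_coef_eq0.
move: (lead_coef p) lc0 => a a0 hr.
have {}hr z : z \in r -> ~ spectrum A z.
  by move=> zr; apply: hr; rewrite rootZ// root_prod_XsubC.
elim: r hr => [|z r IH] hr.
  have a00 : 0 < `|a| by rewrite normr_gt0.
  have [aE a1] := pos_complexE `|a| a00.
  exists (complex.Re `|a|) => // x.
  by rewrite big_nil alg_polyC poly_opC rnormZ.
have [|c c0 hc] := IH; first by move=> w wr; apply: hr; rewrite inE wr orbT.
have [d d0 hdd] := not_spectrum_bounded_below z (hr z (mem_head _ _)).
exists (d * c) => [|x]; first by rewrite mulr_gt0.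
rewrite big_cons -mul_polyC mulrCA mul_polyC poly_opM poly_opD -polyCN poly_opC.
rewrite poly_opX scaleNr.
by rewrite -mulrA (le_trans _ (hdd _))// ler_wpM2l ?hc// ltW.
Qed.

(** Let [m] be the best lower bound of the quadratic form of [q(A)], and suppose [m < 0]. Then
    [W = q - m] is positive on the spectrum, so [W(A)] is bounded below by some [c > 0]; it is also
    a positive operator, so [|W(A) x|^2 <= M' ip (W(A) x) x]. Hence [m + c^2 / M'] is a lower bound
    too, against maximality. Nonconstancy serves to give [W != 0]. *)
Let rpoly_op_ge0_nonconst (q : {poly R}) : (1 < size q)%N ->
  (forall l : R, spectrum A l%:C -> 0 <= q.[l]) ->
  forall x, 0 <= '<<rpoly_op q A x, x>>.
Proof.
move=> q1 hq x0; rewrite leNgt; apply/negP => neg.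
have x0n : 0 < '<<x0, x0>>.
  rewrite lt_neqAle ip_ge0// andbT; apply/eqP => e.
  have x00 : x0 = 0.
    apply: rnorm_eq0; apply/eqP; rewrite -sqrf_eq0.
    by rewrite (rnorm_sqr dot hd) -e.
  by move: neg; rewrite x00 -(scale0r (0 : H)) -(rmorph0 (real_complex R)) ipZr mul0r ltxx.
have [M M0 hM] := rpoly_op_bounded q.
pose E := [set m : R | forall x, m * '<<x, x>> <= '<<rpoly_op q A x, x>>].
have supE : has_sup E.
  split.
    exists (- M) => x /=.
    have := ip_young dot hd M^-1 (rpoly_op q A x) (- x).
    rewrite invr_gt0 => /(_ M0); rewrite !ipE opprK invrK -!(rnorm_sqr dot hd).
    have : M^-1 * rnorm (rpoly_op q A x) ^+ 2 <= M * rnorm x ^+ 2.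
      rewrite ler_pdivrMl// mulrA -expr2 -exprMn.
      by rewrite ler_pXn2r ?nnegrE ?mulr_ge0 ?rnorm_ge0 ?(ltW M0).
    lra.
  exists ('<<rpoly_op q A x0, x0>> / '<<x0, x0>>) => m /(_ x0).
  by rewrite ler_pdivlMr.
set m := sup E.
have Em : E m.
  move=> x; apply/ler_addgt0Pr => e e0.
  have x1 : 0 < '<<x, x>> + 1 by rewrite ltr_wpDl// ip_ge0.
  have [m' Em' mm'] := sup_adherent (divr_gt0 e0 x1) supE.
  have := Em' x; have : (m - m') * '<<x, x>> <= e.
    have h : m - m' <= e / ('<<x, x>> + 1) by rewrite -/m in mm'; lra.
    apply: (@le_trans _ _ (e / ('<<x, x>> + 1) * '<<x, x>>)).
      by rewrite ler_wpM2r ?ip_ge0.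
    rewrite mulrAC ler_pdivrMr// ler_wpM2l ?(ltW e0)//; lra.
  lra.
have mneg : m < 0.
  have := Em x0; have := ip_ge0 dot hd x0 => a b; nra.
pose W : {poly R} := q - m%:P.
have W1 : W != 0.
  apply/eqP => W0; have qm : q = m%:P by apply/eqP; rewrite -subr_eq0 -/W W0.
  by move: q1; rewrite qm size_polyC; case: (_ != _).
have WE x : rpoly_op W A x = rpoly_op q A x - m%:C *: x.
  by rewrite /W rpoly_opD rpoly_opN rpoly_opC.
have WC0 : map_poly (real_complex R) W != 0 by rewrite map_poly_eq0.
have [z|c c0 hc] := poly_op_bounded_below _ WC0.
  move=> zr zA; have [l zl] := spectrum_real dot hd A hA z zA.
  move: zr zA; rewrite zl /root horner_map/= => /eqP/complexI Wl /hq.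
  move: Wl; rewrite /W hornerD hornerN hornerC; lra.
have [M' M'0 hM'] := rpoly_op_bounded W.
have Wlin : linear (rpoly_op W A) by move=> a x y; exact: rpoly_op_linear.
pose Wl : {linear H -> H} := HB.pack (rpoly_op W A) (GRing.isLinear.Build _ _ _ _ _ Wlin).
have Wsq x : rnorm (rpoly_op W A x) ^+ 2 <= M' * '<<rpoly_op W A x, x>>.
  apply: (@pos_sym_sqr_le R H dot Wl M') => // {}x.
    by move=> y; exact: rpoly_op_sym.
  by have := Em x; rewrite /= WE !ipE; lra.
have : E (m + c ^+ 2 / M').
  move=> x; have := Wsq x; rewrite -ler_pdivrMl// WE !ipE -WE.
  have : M'^-1 * (c ^+ 2 * '<<x, x>>) <= M'^-1 * rnorm (rpoly_op W A x) ^+ 2.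
    rewrite ler_wpM2l ?invr_ge0 ?(ltW M'0)// -(rnorm_sqr dot hd) -exprMn.
    by rewrite ler_pXn2r ?nnegrE ?mulr_ge0 ?rnorm_ge0 ?(ltW c0)// hc.
  lra.
move/(sup_ubound supE.2); rewrite -/m.
have : 0 < c ^+ 2 / M' by rewrite divr_gt0// exprn_gt0.
lra.
Qed.

Lemma rpoly_op_ge0 (q : {poly R}) :
  (forall l : R, spectrum A l%:C -> 0 <= q.[l]) ->
  forall x, 0 <= '<<rpoly_op q A x, x>>.
Proof.
move=> hq x; have [q1|] := ltnP 1 (size q); first exact: rpoly_op_ge0_nonconst.
move=> /size1_polyC qc; move: hq; rewrite qc; move: (q`_0) => c hq.
have [c0|c0] := leP 0 c.
  by rewrite rpoly_opC !ipE mulr_ge0// ip_ge0.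
(* A negative constant meets the hypothesis only if the spectrum has no real point; the nonconstant
   case then applies vacuously to [- 'X - 1] and forces [x = 0]. *)
have x00 : '<<x, x>> = 0.
  have := rpoly_op_ge0_nonconst (- 'X - 1%:P) _ _ x.
  rewrite rpoly_opD !rpoly_opN rpoly_opX rpoly_opC !ipE mul1r => h.
  apply/eqP; rewrite eq_le ip_ge0// andbT.
  have := pA x; suff : 0 <= - '<<A x, x>> - '<<x, x>> by lra.
  apply: h; first by rewrite -opprD size_polyN size_XaddC.
  by move=> l /hq; rewrite hornerC => ?; lra.
by rewrite rpoly_opC !ipE x00 mulr0.
Qed.

(** Split [p = p1 + i p2] with real [p1], [p2]. Their operators commute and are symmetric, so the
    cross term is zero and the claim is positivity of [e^2 - p1^2 - p2^2] on the spectrum. *)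
Lemma poly_op_bound (p : {poly R[i]}) (e : R) : 0 <= e ->
  (forall z : R[i], spectrum A z -> `|p.[z]| <= e%:C) ->
  forall x, rnorm (poly_op p A x) <= e * rnorm x.
Proof.
move=> e0 hp x.
pose p1 : {poly R} := \poly_(i < size p) complex.Re p`_i.
pose p2 : {poly R} := \poly_(i < size p) complex.Im p`_i.
have pE : p = map_poly (real_complex R) p1 + 'i%C *: map_poly (real_complex R) p2.
  by apply/polyP => i; rewrite coefD coefZ !coef_map; exact: complexE.
have xE : poly_op p A x = rpoly_op p1 A x + 'i%C *: rpoly_op p2 A x.
  by rewrite {1}pE poly_opD poly_opZ.
have iu0 : '<<rpoly_op p1 A x, 'i%C *: rpoly_op p2 A x>> = 0.
  have E1 : '<<rpoly_op p1 A x, 'i%C *: rpoly_op p2 A x>> =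
      - '<<'i%C *: rpoly_op p1 A x, rpoly_op p2 A x>> by exact: ip_iz.
  have rZ q (z : R[i]) y : rpoly_op q A (z *: y) = z *: rpoly_op q A y.
    by rewrite /rpoly_op -!(poly_opC A) -!poly_opM mulrC.
  have E2 : '<<rpoly_op p1 A x, 'i%C *: rpoly_op p2 A x>> =
      '<<'i%C *: rpoly_op p1 A x, rpoly_op p2 A x>>.
    rewrite -rZ -rpoly_op_sym// -rpoly_opM mulrC rpoly_opM.
    by rewrite rpoly_op_sym// -[in RHS]rZ ipC rpoly_op_sym// ipC.
  lra.
rewrite -(@ler_pXn2r _ 2) ?nnegrE ?mulr_ge0 ?rnorm_ge0//.
rewrite xE exprMn [leLHS](rnorm_sqr dot hd) !ipE (ipC dot ('i%C *: _) (rpoly_op p1 A x)) iu0.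
have -> : '<<'i%C *: rpoly_op p2 A x, 'i%C *: rpoly_op p2 A x>> =
    '<<rpoly_op p2 A x, rpoly_op p2 A x>>.
  rewrite -!(rnorm_sqr dot hd) rnormZ normc_def/= expr0n expr1n add0r.
  by rewrite sqrtr1 mul1r.
have := rpoly_op_ge0 ((e ^+ 2)%:P - (p1 * p1 + p2 * p2)) _ x.
rewrite rpoly_opD rpoly_opN rpoly_opD !rpoly_opM rpoly_opC !ipE.
rewrite !(rpoly_op_sym _ dot _ (rpoly_op _ A x))// -(rnorm_sqr dot hd) => h.
rewrite -subr_ge0; suff : 0 <= e ^+ 2 * rnorm x ^+ 2 -
  ('<<rpoly_op p1 A x, rpoly_op p1 A x>> + '<<rpoly_op p2 A x, rpoly_op p2 A x>>) by lra.
apply: h => l /hp.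
have -> : p.[l%:C] = (p1.[l])%:C + 'i%C * (p2.[l])%:C.
  by rewrite {1}pE -mul_polyC hornerD hornerM hornerC !horner_map.
rewrite normc_def lecR/= !mul0r mul1r subr0 !addr0 !add0r !hornerE => h.
have := sqr_ge0 (p1.[l]); have := sqr_ge0 (p2.[l]) => s2 s1.
rewrite -(@ler_pXn2r _ 2) ?nnegrE ?sqrtr_ge0// sqr_sqrtr ?addr_ge0// in h.
by rewrite -!expr2 subr_ge0.
Qed.

End positive_calculus.

(** * Functional calculus *)

(** The Muntz estimate with exponents 1, 2, 3, ... plays the part of Weierstrass' theorem. *)
Lemma powR_poly_approx {R : realType} (q : R) : 0 < q -> forall e, 0 < e ->
  exists p : {poly R}, forall l, 0 <= l <= 1 -> `|p.[l] - l `^ q| <= e.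
Proof.
move=> q0 e e0.
pose u (i : nat) : R := i.+1%:R.
have u0 i : 0 < u i by rewrite ltr0n.
have uI : injective u by move=> i j /eqP; rewrite eqr_nat => /eqP[].
have [||n hn] := @prod_one_minus_cvg0 R u q 1 u0 ltr01 _ _ q0 e e0.
  by move=> i; rewrite mul1r.
  move=> B; exists (Num.trunc B).+1 => i hi.
  by rewrite ltW// (lt_le_trans (truncnS_gt B))// ler_nat (leq_trans hi).
have [a ha] := @muntz R u q n u0 uI q0.
exists (\sum_(i < n) a i *: 'X^(i.+1)) => l l01.
rewrite distrC (le_trans _ hn)// (le_trans _ (ha l l01))//.
rewrite horner_sum; under eq_bigr do rewrite hornerZ hornerXn.
case/andP: l01 => l0 _; under [X in _ <= `|_ - X|]eq_bigr do rewrite powR_mulrn//.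
exact: lexx.
Qed.

(* [B] is [f(A)], for [A] a positive contraction. *)
Definition fcalc {R : realType} {H : completeNormedModType R[i]}
    (A : H -> H) (f : R -> R) (B : H -> H) : Prop :=
  forall e : R, 0 < e -> exists2 p : {poly R},
    forall l, 0 <= l <= 1 -> `|p.[l] - f l| <= e
  & forall x, rnorm (rpoly_op p A x - B x) <= e * rnorm x.

Section functional_calculus.
Context {R : realType} {H : completeNormedModType R[i]}.
Context (dot : {dot H for Num.conj}) (hd : hilbert_dot dot).
Context (A : {linear H -> H}) (hA : positive_contraction dot A).
Local Notation "'<< x , y >>" := (ip dot x y).

Lemma rpoly_op_diff_bound (p q : {poly R}) (e : R) : 0 <= e ->
  (forall l, 0 <= l <= 1 -> `|p.[l] - q.[l]| <= e) ->
  forall x, rnorm (rpoly_op p A x - rpoly_op q A x) <= e * rnorm x.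
Proof.
move=> e0 pq x; rewrite -rpoly_opN -rpoly_opD.
apply: (@poly_op_bound R H dot hd A hA) => // z zA.
have [l zl] := spectrum_real dot hd A hA z zA.
rewrite zl horner_map/= normc_def/= expr0n addr0 sqrtr_sqr lecR hornerD hornerN.
by apply: pq; apply: (@spectrum_unit R H dot hd A hA); rewrite -zl.
Qed.

Lemma fcalc_rpoly (p : {poly R}) : fcalc A (horner p) (rpoly_op p A).
Proof.
move=> e e0; exists p => [l _|x]; first by rewrite subrr normr0 ltW.
by rewrite subrr rnorm0 mulr_ge0 ?rnorm_ge0// ltW.
Qed.

Lemma fcalcB f g B D : fcalc A f B -> fcalc A g D ->
  fcalc A (fun l => f l - g l) (fun x => B x - D x).
Proof.
move=> fB gD e e0.
have [p pf pB] := fB (e / 2) (divr_gt0 e0 (ltr0n _ 2)).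
have [q qg qD] := gD (e / 2) (divr_gt0 e0 (ltr0n _ 2)).
exists (p - q) => [l l01|x].
  rewrite hornerD hornerN (_ : _ - _ = (p.[l] - f l) - (q.[l] - g l)); last by ring.
  by rewrite (le_trans (ler_normB _ _))// [leRHS]splitr lerD// ?pf ?qg.
rewrite rpoly_opD rpoly_opN.
have -> : rpoly_op p A x - rpoly_op q A x - (B x - D x) =
    (rpoly_op p A x - B x) - (rpoly_op q A x - D x).
  by rewrite opprD addrACA -opprD.
by rewrite (le_trans (rnormB _ _))// (splitr e) mulrDl lerD.
Qed.

Lemma fcalcZ (c : R) f B : fcalc A f B -> fcalc A (fun l => c * f l) (fun x => c%:C *: B x).
Proof.
move=> fB e e0.
have c1 : 0 < `|c| + 1 by rewrite ltr_wpDl.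
have [p pf pB] := fB (e / (`|c| + 1)) (divr_gt0 e0 c1).
have ce : `|c| * (e / (`|c| + 1)) <= e.
  by rewrite mulrA ler_pdivrMr// mulrC ler_wpM2l ?(ltW e0)// lerDl.
exists (c *: p) => [l l01|x].
  by rewrite hornerZ -mulrBr normrM (le_trans _ ce)// ler_wpM2l// pf.
rewrite rpoly_opZ -scalerBr rnormZr (le_trans (ler_wpM2l _ (pB x)))//.
by rewrite mulrA ler_wpM2r ?rnorm_ge0.
Qed.

Lemma fcalc0 : fcalc A (fun=> 0) (fun=> 0).
Proof.
move=> e e0; exists 0 => [l _|x]; first by rewrite horner0 subrr normr0 ltW.
by rewrite rpoly_opC scale0r subrr rnorm0 mulr_ge0 ?rnorm_ge0// ltW.
Qed.

Lemma fcalc_sum n (f : nat -> R -> R) (B : nat -> H -> H) :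
  (forall i, fcalc A (f i) (B i)) ->
  fcalc A (fun l => \sum_(i < n) f i l) (fun x => \sum_(i < n) B i x).
Proof.
move=> fB; elim: n => [|n IH].
  have := fcalc0; congr (fcalc A _ _); apply/funext => ?; by rewrite big_ord0.
have := fcalcB _ _ _ _ IH (fcalcZ (-1) _ _ (fB n)); congr (fcalc A _ _).
  by apply/funext => l; rewrite big_ord_recr/= mulN1r opprK.
by apply/funext => x; rewrite big_ord_recr/= rmorphN1 scaleN1r opprK.
Qed.

(** Replace each [f i] by a polynomial within [e], use positivity of
    [(1 + e) h + n (e + e^2) - sum p_i^2], and let [e] tend to 0 for fixed [n]. Bounding the sum
    jointly leaves no factor [n] in the result. *)
Lemma fcalc_quad n (f : nat -> R -> R) (B : nat -> H -> H) (h : {poly R}) :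
  (forall i, fcalc A (f i) (B i)) ->
  (forall l, 0 <= l <= 1 -> \sum_(i < n) f i l ^+ 2 <= h.[l]) ->
  forall x, \sum_(i < n) rnorm (B i x) ^+ 2 <= '<<rpoly_op h A x, x>>.
Proof.
move=> fB fh x; set P := '<<_, _>>; set X := rnorm x ^+ 2.
have X0 : 0 <= X by exact: sqr_ge0.
have key (e : R) : 0 < e -> e <= 1 ->
    \sum_(i < n) rnorm (B i x) ^+ 2 <= P + e * (3 * `|P| + 6 * n%:R * X).
  move=> e0 e1.
  have sq (a b d : R) : 0 <= b -> 0 <= d -> 0 <= a <= b + e * d ->
      a ^+ 2 <= (1 + e) * b ^+ 2 + (e + e ^+ 2) * d ^+ 2.
    move=> b0 d0 /andP[a0 ab].
    apply: (@le_trans _ _ ((b + e * d) ^+ 2)).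
      by rewrite ler_pXn2r ?nnegrE ?addr_ge0 ?mulr_ge0 ?(ltW e0).
    have : 0 <= e * (b - d) ^+ 2 by rewrite mulr_ge0 ?sqr_ge0 ?(ltW e0).
    nra.
  have /choice[p hp] : forall i, exists p : {poly R},
      (forall l, 0 <= l <= 1 -> `|p.[l] - f i l| <= e) /\
      (forall x, rnorm (rpoly_op p A x - B i x) <= e * rnorm x).
    by move=> i; have [p ? ?] := fB i e e0; exists p.
  have E1 i : rnorm (B i x) ^+ 2 <=
      (1 + e) * rnorm (rpoly_op (p i) A x) ^+ 2 + (e + e ^+ 2) * X.
    apply: sq; rewrite ?rnorm_ge0//=.
    have [_ /(_ x)] := hp i; rewrite rnorm_distC.
    have := rnormD (B i x - rpoly_op (p i) A x) (rpoly_op (p i) A x).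
    by rewrite subrK; lra.
  have E2 l : 0 <= l <= 1 -> \sum_(i < n) (p i).[l] ^+ 2 <=
      (1 + e) * h.[l] + n%:R * (e + e ^+ 2).
    move=> l01; apply: (@le_trans _ _ (\sum_(i < n) ((1 + e) * f i l ^+ 2 + (e + e ^+ 2)))).
      apply: ler_sum => i _.
      have [/(_ l l01) hi _] := hp i.
      have H2 : 0 <= `|(p i).[l]| <= `|f i l| + e * 1.
        rewrite normr_ge0/= mulr1 -{1}(subrK (f i l) (p i).[l]).
        by rewrite (le_trans (ler_normD _ _))// addrC lerD2l.
      have := sq _ _ _ (normr_ge0 _) ler01 H2.
      by rewrite !real_normK ?num_real// expr1n mulr1.
    rewrite big_split/= sumr_const card_ord -[_ *+ n]mulr_natl lerD2r -mulr_sumr.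
    by rewrite ler_wpM2l ?fh// addr_ge0// ltW.
  have E3 : \sum_(i < n) rnorm (rpoly_op (p i) A x) ^+ 2 <=
      (1 + e) * P + n%:R * (e + e ^+ 2) * X.
    have := @rpoly_op_ge0 R H dot hd A hA
      ((1 + e) *: h + (n%:R * (e + e ^+ 2))%:P - \sum_(i < n) p i * p i) _ x.
    rewrite rpoly_opD rpoly_opN rpoly_opD (rpoly_op_sum A n (fun i => p i * p i)).
    rewrite rpoly_opZ rpoly_opC !ipE.
    rewrite -/P -(rnorm_sqr dot hd) -/X.
    have -> : '<<\sum_(i < n) rpoly_op (p i * p i) A x, x>> =
        \sum_(i < n) rnorm (rpoly_op (p i) A x) ^+ 2.
      elim: (n) => [|k IH].
        by rewrite !big_ord0 -(scale0r (0 : H)) -(rmorph0 (real_complex R)) ipZl mul0r.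
      rewrite !big_ord_recr/= ipDl IH rpoly_opM rpoly_op_sym; last by case: hA.
      by rewrite -(rnorm_sqr dot hd).
    move=> G; rewrite -subr_ge0; apply: G => l /(@spectrum_unit R H dot hd A hA) l01.
    rewrite hornerD hornerN hornerD hornerZ hornerC horner_sum subr_ge0.
    by have := E2 l l01; under eq_bigr do rewrite expr2 -hornerM.
  apply: (@le_trans _ _ (\sum_(i < n)
      ((1 + e) * rnorm (rpoly_op (p i) A x) ^+ 2 + (e + e ^+ 2) * X))).
    exact: ler_sum.
  rewrite big_split/= sumr_const card_ord -[_ *+ n]mulr_natl -mulr_sumr.
  have e2 : e ^+ 2 <= e by rewrite expr2 ler_piMl// ltW.
  have : (1 + e) * \sum_(i < n) rnorm (rpoly_op (p i) A x) ^+ 2 <=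
    (1 + e) * ((1 + e) * P + n%:R * (e + e ^+ 2) * X).
    by rewrite ler_wpM2l// addr_ge0// ltW.
  have P1 := ler_norm P.
  have nX0 : 0 <= n%:R * X by rewrite mulr_ge0.
  have : (1 + e) * (1 + e) * P <= P + 3 * e * `|P|.
    have : (2 * e + e ^+ 2) * P <= (2 * e + e ^+ 2) * `|P|.
      by rewrite ler_wpM2l// addr_ge0 ?sqr_ge0// mulr_ge0// ltW.
    have : e ^+ 2 * `|P| <= e * `|P| by rewrite ler_wpM2r.
    lra.
  have : (2 + e) * (e + e ^+ 2) * (n%:R * X) <= 6 * e * (n%:R * X).
    rewrite ler_wpM2r//; nra.
  lra.
apply/ler_addgt0Pr => e e0.
set K := 3 * `|P| + 6 * n%:R * X in key.
have K0 : 0 <= K.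
  exact: addr_ge0 (mulr_ge0 (ler0n _ _) (normr_ge0 _)) (mulr_ge0 (mulr_ge0 (ler0n _ _) (ler0n _ _)) X0).
pose d := Num.min 1 (e / (K + 1)).
have K1 : 0 < K + 1 by lra.
have d0 : 0 < d by rewrite lt_min ltr01 divr_gt0.
apply: le_trans (key d d0 _) _; first by rewrite ge_min lexx.
rewrite lerD2l; apply: (@le_trans _ _ (e / (K + 1) * K)).
  by rewrite ler_wpM2r// ge_min lexx orbT.
by rewrite mulrAC ler_pdivrMr// ler_wpM2l ?(ltW e0)//; lra.
Qed.

Lemma fcalc_bound (f : R -> R) (B : H -> H) (M : R) :
  0 <= M -> fcalc A f B -> (forall l, 0 <= l <= 1 -> `|f l| <= M) ->
  forall x, rnorm (B x) <= M * rnorm x.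
Proof.
move=> M0 fB fM x.
have := @fcalc_quad 1%N (fun=> f) (fun=> B) (M ^+ 2)%:P (fun=> fB) _ x.
rewrite big_ord1 rpoly_opC !ipE -(rnorm_sqr dot hd) -exprMn => h.
rewrite -(@ler_pXn2r _ 2) ?nnegrE ?mulr_ge0 ?rnorm_ge0//; apply: h => l l01.
rewrite big_ord1 hornerC -real_normK ?num_real//.
by rewrite ler_pXn2r ?nnegrE// fM.
Qed.

(** [cfc] is a choice made by [get], so its specification holds only once some operator is known to
    satisfy it. The pointwise limit [B] of the [r n (A)] is that witness; applying the specification
    of [cfc] to the sequence [r] itself then gives the approximations. *)
Lemma fcalc_cfc (f : R -> R) :
  (forall e : R, 0 < e -> exists p : {poly R}, forall l, 0 <= l <= 1 -> `|p.[l] - f l| <= e) ->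
  fcalc A f (cfc A (fun z => (f (complex.Re z))%:C)).
Proof.
move=> fp.
have /choice[r hr] : forall n : nat, exists p : {poly R},
    forall l, 0 <= l <= 1 -> `|p.[l] - f l| <= n.+1%:R^-1.
  by move=> n; apply: fp; rewrite invr_gt0.
have rdiff n m x : rnorm (rpoly_op (r n) A x - rpoly_op (r m) A x) <=
    (n.+1%:R^-1 + m.+1%:R^-1) * rnorm x.
  apply: rpoly_op_diff_bound => [|l l01]; first by rewrite addr_ge0.
  rewrite -(subrKA (f l)) (le_trans (ler_normD _ _))// lerD ?hr//.
  by rewrite distrC hr.
have small (e : R) : 0 < e -> exists n0, forall n, (n0 <= n)%N -> n.+1%:R^-1 <= e.
  move=> e0; have /cvgrPdist_le/(_ e e0)[n0 _ hn0] := @cvg_harmonic R.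
  exists n0 => n nn; have := hn0 n nn.
  by rewrite sub0r normrN ger0_norm// harmonic_ge0.
have smallM (e C : R) : 0 < e -> 0 <= C ->
    exists n0, forall n, (n0 <= n)%N -> n.+1%:R^-1 * C <= e.
  move=> e0 C0; have C1 : 0 < C + 1 by lra.
  have [n0 hn0] := small _ (divr_gt0 e0 C1); exists n0 => n /hn0.
  rewrite ler_pdivlMr//; apply: le_trans.
  by rewrite ler_wpM2l//; lra.
have /choice[B hB] : forall x, exists l, forall e : R, 0 < e -> exists n0, forall n,
    (n0 <= n)%N -> rnorm (rpoly_op (r n) A x - l) <= e.
  move=> x; apply: rnorm_cauchy_cvg => e e0.
  have [n0 hn0] := smallM (e / 2) (rnorm x) (divr_gt0 e0 (ltr0n _ 2)) (rnorm_ge0 x).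
  exists n0 => n m nn mm; rewrite (le_trans (rdiff n m x))// mulrDl (splitr e).
  by rewrite lerD// hn0.
have rB n x : rnorm (rpoly_op (r n) A x - B x) <= 2 * n.+1%:R^-1 * rnorm x.
  apply/ler_addgt0Pr => e e0; have [n0 hn0] := hB x e e0.
  pose m := maxn n n0.
  rewrite -(subrKA (rpoly_op (r m) A x)) (le_trans (rnormD _ _))// lerD//; last first.
    by rewrite hn0// leq_maxr.
  rewrite (le_trans (rdiff n m x))// ler_wpM2r ?rnorm_ge0//.
  have : m.+1%:R^-1 <= n.+1%:R^-1 :> R.
    by rewrite lef_pV2 ?posrE// ler_nat ltnS leq_maxl.
  by move: (m.+1%:R^-1) (n.+1%:R^-1) => a b; lra.
have linB : linear B.
  move=> z x y; apply/eqP; rewrite -subr_eq0; apply/eqP/rnorm_eq0.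
  apply/eqP; rewrite eq_le rnorm_ge0 andbT; apply/ler_addgt0Pr => e e0; rewrite add0r.
  pose C := 2 * (rnorm (z *: x + y) + complex.Re `|z| * rnorm x + rnorm y).
  have z0 : 0 <= complex.Re `|z| by rewrite normc_def/= sqrtr_ge0.
  have C0 : 0 <= C by rewrite mulr_ge0 ?addr_ge0 ?mulr_ge0 ?rnorm_ge0.
  have [n0 hn0] := smallM e C e0 C0.
  apply: le_trans (hn0 n0 (leqnn _)).
  have -> : B (z *: x + y) - (z *: B x + B y) =
     (z *: (rpoly_op (r n0) A x - B x) + (rpoly_op (r n0) A y - B y))
     - (rpoly_op (r n0) A (z *: x + y) - B (z *: x + y)).
    have E (u v w : H) : v - w = (u - w) - (u - v) by rewrite opprB [RHS]addrC subrKA.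
    rewrite [LHS](E (rpoly_op (r n0) A (z *: x + y))) {1}rpoly_op_linear.
    by rewrite (opprD (z *: B x)) addrACA -scalerBr.
  rewrite (le_trans (rnormB _ _))//.
  have h1 := rB n0 (z *: x + y); have h2 := rB n0 y.
  have h3 := ler_wpM2l z0 (rB n0 x).
  have h4 := rnormD (z *: (rpoly_op (r n0) A x - B x)) (rpoly_op (r n0) A y - B y).
  rewrite rnormZ in h4; rewrite /C.
  by move: (n0.+1%:R^-1) h1 h2 h3 h4 => a h1 h2 h3 h4; lra.
set F := fun z : R[i] => (f (complex.Re z))%:C.
have Bcfc (p : nat -> {poly R[i]}) :
    (forall e : R, 0 < e -> \forall n \near \oo, forall z : R[i],
       spectrum A z -> `|(p n).[z] - F z| <= e%:C) ->
    forall e : R, 0 < e -> \forall n \near \oo, forall x : H,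
       `|poly_op (p n) A x - B x| <= e%:C * `|x|.
  (* Comparison through [r m] costs [e / 2] from [p n], [1 / (m + 1)] on the spectrum and
     [2 / (m + 1)] from [rB]; [e / 6] makes the total [e]. *)
  move=> hp e e0; have [m hm] := small (e / 6) (divr_gt0 e0 (ltr0n _ 6)).
  have {}hm := hm m (leqnn _).
  have [n0 _ hn0] := hp (e / 2) (divr_gt0 e0 (ltr0n _ 2)).
  exists n0 => // n nn x; rewrite !rnormE -rmorphM lecR.
  rewrite -(subrKA (rpoly_op (r m) A x)) (le_trans (rnormD _ _))//.
  have h1 := rB m x.
  have : rnorm (poly_op (p n) A x - rpoly_op (r m) A x) <=
      (e / 2 + m.+1%:R^-1) * rnorm x.
    rewrite -rpoly_opN -poly_opD; apply: (@poly_op_bound R H dot hd A hA).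
      by rewrite addr_ge0// divr_ge0// ltW.
    move=> z zA; have [l zl] := spectrum_real dot hd A hA z zA.
    have l01 : 0 <= l <= 1 by apply: (@spectrum_unit R H dot hd A hA); rewrite -zl.
    rewrite hornerD rmorphN hornerN -(subrKA (F z)) (le_trans (ler_normD _ _))//.
    rewrite rmorphD lerD ?hn0//= zl horner_map/= /F -rmorphB normc_def/= expr0n addr0.
    by rewrite sqrtr_sqr lecR distrC hr.
  have x0 := rnorm_ge0 x.
  have : m.+1%:R^-1 * rnorm x <= e / 6 * rnorm x by rewrite ler_wpM2r.
  by move: (m.+1%:R^-1) h1 hm => a h1 hm; lra.
have [_ hcfc] : linear (cfc A F) /\ forall p : nat -> {poly R[i]},
    (forall e : R, 0 < e -> \forall n \near \oo, forall z : R[i],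
       spectrum A z -> `|(p n).[z] - F z| <= e%:C) ->
    forall e : R, 0 < e -> \forall n \near \oo, forall x : H,
       `|poly_op (p n) A x - cfc A F x| <= e%:C * `|x|.
  have : [set D : H -> H | linear D /\ forall p : nat -> {poly R[i]},
      (forall e : R, 0 < e -> \forall n \near \oo, forall z : R[i],
         spectrum A z -> `|(p n).[z] - F z| <= e%:C) ->
      forall e : R, 0 < e -> \forall n \near \oo, forall x : H,
         `|poly_op (p n) A x - D x| <= e%:C * `|x|] (cfc A F).
    by apply: getPex; exists B; split.
  by [].
move=> e e0; have [|n0 _ hn0] := hcfc (fun n => map_poly (real_complex R) (r n)) _ e e0.
  move=> d d0; have [m hm] := small d d0; exists m => // n nm z zA.
  have [l zl] := spectrum_real dot hd A hA z zA.
  have l01 : 0 <= l <= 1 by apply: (@spectrum_unit R H dot hd A hA); rewrite -zl.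
  rewrite zl horner_map/= /F -rmorphB normc_def/= expr0n addr0 sqrtr_sqr lecR.
  by rewrite (le_trans (hr _ _ l01))// hm.
have [n1 hn1] := small e e0.
pose n := maxn n0 n1; exists (r n).
  by move=> l l01; rewrite (le_trans (hr _ _ l01))// hn1// leq_maxr.
move=> x; have := hn0 n (leq_maxl _ _) x.
by rewrite !rnormE -rmorphM lecR.
Qed.

Lemma fcalc_op_pow (s : R) : 0 <= s -> fcalc A (fun l => l `^ s) (op_pow A s).
Proof.
rewrite le_eqVlt => /orP[/eqP<-|s0]; rewrite /op_pow.
  (* The zeroth power is 1 also at [l = 0], in agreement with [idfun]. *)
  rewrite eqxx => e e0; exists 1%:P => [l _|x].
    by rewrite hornerC powRr0 subrr normr0 ltW.
  by rewrite rpoly_opC scale1r subrr rnorm0 mulr_ge0 ?rnorm_ge0// ltW.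
rewrite gt_eqF//; exact/(fcalc_cfc (fun l => l `^ s))/powR_poly_approx.
Qed.

Lemma fcalc_iter (n : nat) : fcalc A (fun l => l ^+ n) (iter n A).
Proof.
have := fcalc_rpoly 'X^n; congr (fcalc A _ _).
  by apply/funext => l; rewrite hornerXn.
by apply/funext => x; rewrite rpoly_opXn.
Qed.

End functional_calculus.

(** * Observability *)

Lemma fin_sum_le_widen {R : realType} (g : nat -> R) (m n : nat) :
  (forall k, 0 <= g k) -> (m <= n)%N -> \sum_(k < m) g k <= \sum_(k < n) g k.
Proof.
move=> g0 /subnKC <-; rewrite big_split_ord/= lerDl.
by apply: sumr_ge0 => i _; exact: g0.
Qed.

Lemma fin_sum_block {R : realType} (g : nat -> R) (N n : nat) :
  \sum_(m < N * n) g m = \sum_(k < n) \sum_(i < N) g (N * k + i)%N.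
Proof.
elim: n => [|n IH]; first by rewrite muln0 !big_ord0.
by rewrite big_ord_recr/= -IH mulnSr big_split_ord.
Qed.

(** [K] depends on the coefficients alone, so one constant serves all [x] in the Muntz step. *)
Lemma rnorm_sum_sqr_le {R : realType} {V : normedModType R[i]} (n : nat) (c : nat -> R) :
  exists2 K, 0 <= K & forall v : nat -> V,
    rnorm (\sum_(i < n) (c i)%:C *: v i) ^+ 2 <= K * \sum_(i < n) rnorm (v i) ^+ 2.
Proof.
elim: n => [|n [K K0 hK]].
  by exists 0 => // v; rewrite !big_ord0 rnorm0 expr0n mul0r.
exists (2 * K + 2 * c n ^+ 2) => [|v].
  by have := sqr_ge0 (c n); lra.
rewrite !big_ord_recr/= (le_trans (rnorm_sqrD _ _))//.
rewrite rnormZr exprMn real_normK ?num_real//.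
have S0 : 0 <= \sum_(i < n) rnorm (v i) ^+ 2 by apply: sumr_ge0 => i _; exact: sqr_ge0.
have := hK v; have : 0 <= c n ^+ 2 * \sum_(i < n) rnorm (v i) ^+ 2.
  by rewrite mulr_ge0 ?sqr_ge0.
have : 0 <= K * rnorm (v n) ^+ 2 by rewrite mulr_ge0 ?sqr_ge0.
lra.
Qed.

Section observability.
Context {R : realType} {H Y : completeNormedModType R[i]}.
Context (dot : {dot H for Num.conj}) (hd : hilbert_dot dot).
Context (A : {linear H -> H}) (C : {linear H -> Y}) (a b : R).
Local Notation "'<< x , y >>" := (ip dot x y).
Local Notation obs k x := (rnorm (C (iter k A x)) ^+ 2).

Hypothesis a0 : 0 < a.
Hypothesis ab : a <= b.
Hypothesis upper : forall x n, \sum_(k < n) obs k x <= b * rnorm x ^+ 2.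
Hypothesis lower : forall x s, (forall n, \sum_(k < n) obs k x <= s) ->
  a * rnorm x ^+ 2 <= s.

Let b0 : 0 < b. Proof. exact: lt_le_trans ab. Qed.

Let obs_tail x n m : \sum_(k < m) obs k (iter n A x) <= b * rnorm x ^+ 2.
Proof.
apply: le_trans (upper x (n + m)); rewrite big_split_ord/=.
under eq_bigr do rewrite -iterD addnC.
by rewrite lerDr; apply: sumr_ge0 => i _; exact: sqr_ge0.
Qed.

(* If [|Ax|^2 = q |x|^2] with [q > 1] then, by log-convexity, [|A^n x|^2] grows
   like [q^n], while observability bounds all the powers of [A]. *)
Lemma observable_contraction :
  positive_operator dot A -> positive_contraction dot A.
Proof.
move=> [_ symA posA].
have sA x y : '<<A x, y>> = '<<x, A y>> by rewrite /ip symA.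
split=> // [x|x].
  by have := posA x; rewrite /ip; case: (dot _ _) => u v; rewrite lecE/= => /andP[].
rewrite -(@ler_pXn2r _ 2) ?nnegrE ?rnorm_ge0// leNgt; apply/negP => gt.
pose v n := rnorm (iter n A x) ^+ 2.
have v0 : 0 < v 0%N.
  rewrite lt_neqAle sqr_ge0 andbT; apply/eqP => /esym/eqP.
  rewrite sqrf_eq0 => /eqP/rnorm_eq0 x0.
  by move: gt; rewrite /= in x0; rewrite x0 raddf0 rnorm0 ltxx.
pose q := v 1%N / v 0%N.
have q1 : 1 < q by rewrite ltr_pdivlMr// mul1r.
have qv : q * v 0%N = v 1%N by rewrite divfK// gt_eqF.
have q0 : 0 < q by lra.
(* By symmetry [v n.+1] is the inner product of [A^n x] and [A^(n+2) x]; Young's inequality with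
   weight [q] gives [2 q v_(n+1) <= q^2 v_n + v_(n+2)], and [q v_n <= v_(n+1)] propagates. *)
have step n : q * v n <= v n.+1.
  elim: n => [|n IH]; first by rewrite qv.
  have := ip_young dot hd q (iter n A x) (iter n.+2 A x) q0.
  rewrite -sA -!(rnorm_sqr dot hd) -iterS -/(v n) -/(v n.+1) -/(v n.+2) => h.
  have : q * (2 * v n.+1) <= q * (q * v n + q^-1 * v n.+2) by rewrite ler_wpM2l// ltW.
  rewrite mulrDr [q * (q^-1 * _)]mulrA divff ?gt_eqF// mul1r.
  have : q * (q * v n) <= q * v n.+1 by rewrite ler_wpM2l// ltW.
  lra.
(* Bernoulli's linear lower bound already exceeds the constant [b / a]. *)
have grow n : (1 + n%:R * (q - 1)) * v 0%N <= v n.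
  elim: n => [|n IH]; first by rewrite mul0r addr0 mul1r.
  have vn : v 0%N <= v n.
    apply: le_trans IH; rewrite ler_peMl ?(ltW v0)// lerDl mulr_ge0// subr_ge0 ltW//.
  have := step n; have : (q - 1) * v 0%N <= (q - 1) * v n.
    by rewrite ler_wpM2l// subr_ge0 ltW.
  rewrite -natr1; lra.
have bound n : a * v n <= b * v 0%N by apply: lower => m; exact: obs_tail.
pose n := (Num.trunc (b / a / (q - 1))).+1.
have : b / a / (q - 1) < n%:R by exact: truncnS_gt.
rewrite ltr_pdivrMr ?subr_gt0// ltr_pdivrMr// => hn.
have := bound n; have := grow n => g1 g2.
have : a * ((1 + n%:R * (q - 1)) * v 0%N) <= a * v n by rewrite ler_wpM2l// ltW.
have : b * v 0%N < n%:R * (q - 1) * a * v 0%N by rewrite ltr_pM2r.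
have : 0 < a * v 0%N by rewrite mulr_gt0.
lra.
Qed.

Hypothesis hA : positive_contraction dot A.

Let nC x : rnorm (C x) ^+ 2 <= b * rnorm x ^+ 2.
Proof. by have := upper x 1; rewrite big_ord1. Qed.

Let CB x y : C (x - y) = C x - C y. Proof. exact: raddfB. Qed.

Let iterB n x y : iter n A (x - y) = iter n A x - iter n A y.
Proof. by elim: n => //= n ->; rewrite raddfB. Qed.

(** On [0, 1], [(M + 1) l^M (1 - l) <= (1 - l) (1 + l + ... + l^M) <= 1]. *)
Lemma power_defect_le M x :
  rnorm (iter M A (x - A x)) <= M.+1%:R^-1 * rnorm x.
Proof.
have F : fcalc A (fun l => l ^+ M * (1 - l)) (fun x => iter M A (x - A x)).
  have := fcalcB A _ _ _ _ (fcalc_iter A M) (fcalc_iter A M.+1); congr (fcalc A _ _).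
    by apply/funext => l; rewrite mulrBr mulr1 exprSr.
  by apply/funext => y; rewrite iterB -iterSr.
apply: (@fcalc_bound R H dot hd A hA _ _ _ _ F); first by rewrite invr_ge0.
move=> l /andP[l0 l1]; rewrite ger0_norm ?mulr_ge0 ?exprn_ge0 ?subr_ge0//.
rewrite -[leRHS]mul1r ler_pdivlMr//.
apply: le_trans (sum_geom_le l M.+1 l0).
rewrite mulrAC mulrC ler_wpM2l ?subr_ge0//.
rewrite [leRHS](_ : _ = \sum_(k < M.+1) l ^+ k)// mulr_natr -[X in _ *+ X]card_ord -sumr_const.
apply: ler_sum => k _; rewrite ler_wiXn2l//; last by rewrite -ltnS.
Qed.

Lemma defect_le (e : R) : 0 < e -> exists M : nat, exists2 K, 0 <= K & forall x,
  rnorm (x - A x) ^+ 2 <= e * rnorm x ^+ 2 + K * \sum_(j < M) obs j x.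
Proof.
move=> e0; have ae : 0 < a * e by rewrite mulr_gt0.
(* The observations of [y] from index [M] on are at most [b |x|^2 / (M + 1)^2 <= a e |x|^2]. The
   earlier ones are at most [2 obs k x + 2 obs k.+1 x], whence the 4 in [4 / a]. *)
have [M hM] : exists M : nat, b / (a * e) <= M%:R.
  by exists (Num.trunc (b / (a * e))).+1; rewrite ltW// truncnS_gt.
have a1 := a0.
exists M.+1; exists (4 / a); first by rewrite divr_ge0// ltW.
move=> x; set y := x - A x.
have hs n : \sum_(k < n) obs k y <= 4 * \sum_(j < M.+1) obs j x + a * e * rnorm x ^+ 2.
  apply: (@le_trans _ _ (\sum_(k < M + n) obs k y)).
    by apply: (fin_sum_le_widen (fun k => obs k y)) => [k|]; [exact: sqr_ge0|exact: leq_addl].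
  rewrite big_split_ord/= lerD//.
    have H1 : \sum_(k < M) obs k y <= \sum_(k < M) (2 * obs k x + 2 * obs k.+1 x).
      apply: ler_sum => k _; rewrite iterB CB -iterSr.
      by have := rnorm_sqrD (C (iter k A x)) (- C (iter k.+1 A x)); rewrite rnormN.
    apply: le_trans H1 _; rewrite big_split/= -!mulr_sumr.
    have := fin_sum_le_widen (fun k => obs k x) M M.+1 (fun k => sqr_ge0 _) (leqnSn M).
    have : \sum_(k < M) obs k.+1 x <= \sum_(k < M.+1) obs k x.
      by rewrite [leRHS]big_ord_recl/= lerDr sqr_ge0.
    lra.
  apply: (@le_trans _ _ (b * rnorm (iter M A y) ^+ 2)).
    apply: le_trans (upper _ n); apply: ler_sum => k _.
    by rewrite -iterD (addnC M).
  have Mp : 0 < M.+1%:R :> R by [].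
  apply: (@le_trans _ _ (b * (M.+1%:R^-1 * rnorm x) ^+ 2)).
    rewrite ler_wpM2l ?(ltW b0)// ler_pXn2r ?nnegrE ?mulr_ge0 ?rnorm_ge0 ?invr_ge0//.
    exact: power_defect_le.
  rewrite exprMn mulrA ler_wpM2r ?sqr_ge0//.
  rewrite exprVn ler_pdivrMr ?exprn_gt0//.
  rewrite ler_pdivrMr// mulrC in hM; apply: le_trans hM _.
  rewrite ler_wpM2l ?(ltW ae)// -natrX ler_nat.
  by rewrite expnS expn1 (leq_trans (leqnSn M))// leq_pmulr.
have := lower y _ hs; rewrite -ler_pdivlMl// => h; apply: le_trans h _.
rewrite mulrDr !mulrA mulVf ?gt_eqF// mul1r addrC (mulrC 4) //.
Qed.

Lemma iter_defect_le i x : rnorm (x - iter i A x) <= i%:R * rnorm (x - A x).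
Proof.
elim: i => [|i IH]; first by rewrite subrr rnorm0 mul0r.
rewrite -(subrKA (iter i A x)) (le_trans (rnormD _ _))// -natr1 mulrDl mul1r lerD//.
rewrite iterSr -iterB; elim: i {IH} => //= i IH; apply: le_trans IH.
by case: hA => _ _; apply.
Qed.

(** * Transfer from the times [N k] to the times [t k] *)

Section universal.
Context (t : nat -> R) (N : nat).
Hypothesis hN : (0 < N)%N.
Hypothesis t0 : t 0%N = 0.
Hypothesis tpos : forall k, 0 < t k.+1.
Hypothesis tinj : injective t.
Hypothesis gap : forall e : R, 0 < e -> exists2 D, 0 <= D &
  forall l, 0 <= l <= 1 -> forall n,
    \sum_(k < n) (l `^ t k - l ^+ (N * k)) ^+ 2 <= e + D * (1 - l) ^+ 2.
Hypothesis prod0 : forall q e : R, 0 < q -> 0 < e ->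
  exists n, \prod_(i < n) `|1 - q / t i.+1| <= e.
Local Notation Tobs k x := (rnorm (C (op_pow A (t k) x)) ^+ 2).

Let t_ge0 k : 0 <= t k. Proof. by case: k => [|k]; rewrite ?t0// ltW. Qed.

(** Since [1 - A] is symmetric, the quadratic form of [e + D (1 - 'X)^2] at [A] is
    [e |x|^2 + D |x - A x|^2]; the factor [b] bounds the square of the norm of [C]. *)
Let gap_op (e : R) : 0 < e -> exists2 D, 0 <= D & forall x n,
  \sum_(k < n) rnorm (C (op_pow A (t k) x) - C (iter (N * k) A x)) ^+ 2 <=
    b * (e * rnorm x ^+ 2 + D * rnorm (x - A x) ^+ 2).
Proof.
move=> /gap[D D0 hD]; exists D => // x n.
apply: (@le_trans _ _ (b * \sum_(k < n) rnorm (op_pow A (t k) x - iter (N * k) A x) ^+ 2)).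
  by rewrite mulr_sumr; apply: ler_sum => k _; rewrite -CB.
rewrite ler_wpM2l ?(ltW b0)//.
pose h : {poly R} := e%:P + D *: ((1 - 'X) * (1 - 'X)).
have := @fcalc_quad R H dot hd A hA n (fun k l => l `^ t k - l ^+ (N * k))
  (fun k x => op_pow A (t k) x - iter (N * k) A x) h _ _ x.
have hop z : rpoly_op (1 - 'X) A z = z - A z.
  by rewrite rpoly_opD rpoly_opN rpoly_opX rpoly_opC scale1r.
rewrite /h rpoly_opD rpoly_opZ rpoly_opM rpoly_opC !ipE rpoly_op_sym; last by case: hA.
rewrite hop -!(rnorm_sqr dot hd); apply.
  move=> i; apply: fcalcB; last exact: fcalc_iter.
  exact: (@fcalc_op_pow R H dot hd A hA).
move=> l l01; apply: le_trans (hD l l01 n) _.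
by rewrite !(hornerD, hornerN, hornerZ, hornerM, hornerC, hornerX) -expr2.
Qed.

Let muntz_op j (e : R) : 0 < e -> exists2 K, 0 <= K & forall x s,
  (forall n, \sum_(k < n) Tobs k x <= s) -> obs j x <= e * rnorm x ^+ 2 + K * s.
Proof.
move=> e0; have b1 := b0; case: j => [|j].
  exists 1 => // x s /(_ 1%N); rewrite big_ord1 t0 /op_pow eqxx/= mul1r.
  by move=> /le_trans; apply; rewrite lerDr mulr_ge0 ?sqr_ge0// ltW.
(* With [d <= 1] one has [d^2 <= d], hence [2 b d^2 <= e], the cost of applying [C] to the
   approximation error. The case [j = 0] was exact, as [t 0 = 0]. *)
pose d := Num.min 1 (e / (2 * b)).
have d0 : 0 < d by rewrite lt_min ltr01 divr_gt0// mulr_gt0.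
have db : 2 * b * d ^+ 2 <= e.
  have dd : d ^+ 2 <= e / (2 * b).
    rewrite expr2 -[leRHS]mul1r ler_pM ?(ltW d0)//.
      by rewrite ge_min lexx.
    by rewrite ge_min lexx orbT.
  by move: dd; rewrite ler_pdivlMr ?mulr_gt0// mulrC.
have [n hn] := prod0 j.+1%:R d (ltr0Sn _ _) d0.
have [c hc] := @muntz R (fun i => t i.+1) j.+1%:R n tpos
  (fun i k e => succn_inj (tinj _ _ e)) (ltr0Sn _ _).
have [K K0 hK] := @rnorm_sum_sqr_le R Y n c.
exists (2 * K); first by rewrite mulr_ge0.
move=> x s hs.
pose S z := \sum_(i < n) (c i)%:C *: op_pow A (t i.+1) z.
have F : fcalc A (fun l => l ^+ j.+1 - \sum_(i < n) c i * l `^ t i.+1)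
    (fun z => iter j.+1 A z - S z).
  apply: fcalcB; first exact: fcalc_iter.
  apply: (fcalc_sum A n (fun i l => c i * l `^ t i.+1)
    (fun i z => (c i)%:C *: op_pow A (t i.+1) z)) => i.
  apply: fcalcZ; apply: (@fcalc_op_pow R H dot hd A hA); exact: t_ge0.
have G : rnorm (iter j.+1 A x - S x) <= d * rnorm x.
  apply: (@fcalc_bound R H dot hd A hA _ _ _ (ltW d0) F) => l l01.
  apply: le_trans hn; have := hc l l01; rewrite powR_mulrn//; by case/andP: l01.
have SC : C (S x) = \sum_(i < n) (c i)%:C *: C (op_pow A (t i.+1) x).
  rewrite /S raddf_sum; apply: eq_bigr => i _; exact: lin_scale.
have : obs j.+1 x <= 2 * rnorm (C (iter j.+1 A x - S x)) ^+ 2 + 2 * rnorm (C (S x)) ^+ 2.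
  by rewrite -{1}(subrK (S x) (iter j.+1 A x)) raddfD; exact: rnorm_sqrD.
move=> h; apply: le_trans h _; apply: lerD.
  have : rnorm (iter j.+1 A x - S x) ^+ 2 <= (d * rnorm x) ^+ 2.
    by rewrite ler_pXn2r ?nnegrE ?mulr_ge0 ?rnorm_ge0 ?(ltW d0).
  rewrite exprMn => h1; have h2 := nC (iter j.+1 A x - S x).
  have h3 := ler_wpM2l (ltW b0) h1.
  have h4 := ler_wpM2r (sqr_ge0 (rnorm x)) db.
  lra.
rewrite SC -mulrA ler_wpM2l// (le_trans (hK (fun i => C (op_pow A (t i.+1) x))))// ler_wpM2l//.
apply: le_trans (hs n.+1); rewrite [leRHS]big_ord_recl/= lerDr; exact: sqr_ge0.
Qed.

Let muntz_sum M (e : R) : 0 < e -> exists2 K, 0 <= K & forall x s,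
  (forall n, \sum_(k < n) Tobs k x <= s) ->
  \sum_(j < M) obs j x <= e * rnorm x ^+ 2 + K * s.
Proof.
elim: M e => [|M IH] e e0.
  exists 0 => // x s _; rewrite big_ord0 mul0r addr0 mulr_ge0 ?sqr_ge0// ltW//.
have e2 : 0 < e / 2 by rewrite divr_gt0.
have [K K0 hK] := IH _ e2; have [L L0 hL] := muntz_op M _ e2.
exists (K + L); first by rewrite addr_ge0.
move=> x s hs; rewrite big_ord_recr/=.
have := hK x s hs; have := hL x s hs; lra.
Qed.

Let subseq_upper x n : \sum_(k < n) obs (N * k) x <= b * rnorm x ^+ 2.
Proof.
apply: le_trans (upper x (N * n)); rewrite (fin_sum_block (fun k => obs k x)).
apply: ler_sum => k _.
case: (N) hN k => // N' _ k.
rewrite big_ord_recl/= addn0 lerDl.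
by apply: sumr_ge0 => i _; exact: sqr_ge0.
Qed.

(** Write [m = N k + i] with [i < N]. Replacing [A^i x] by [x] costs at most [N |x - A x|], so each
    of the [N] residues contributes at most [2 s + 2 b N^2 |x - A x|^2]. *)
Let subseq_lower x s : (forall n, \sum_(k < n) obs (N * k) x <= s) ->
  a * rnorm x ^+ 2 <= 2 * N%:R * s + 2 * N%:R ^+ 3 * b * rnorm (x - A x) ^+ 2.
Proof.
move=> hs; apply: lower => n; set d := rnorm (x - A x) ^+ 2.
apply: (@le_trans _ _ (\sum_(m < N * n) obs m x)).
  apply: (fin_sum_le_widen (fun k => obs k x)) => [k|]; first exact: sqr_ge0.
  exact: leq_pmull.
rewrite (fin_sum_block (fun k => obs k x)) exchange_big/=.
apply: (@le_trans _ _ (\sum_(i < N) (2 * s + 2 * (b * (N%:R ^+ 2 * d))))).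
  apply: ler_sum => i _.
  apply: (@le_trans _ _ (\sum_(k < n) (2 * obs (N * k) x + 2 * obs (N * k) (x - iter i A x)))).
    apply: ler_sum => k _; rewrite iterD.
    have -> : C (iter (N * k) A (iter i A x)) =
        C (iter (N * k) A x) - C (iter (N * k) A (x - iter i A x)).
      by rewrite iterB CB opprB addrC subrK.
    by have := rnorm_sqrD (C (iter (N * k) A x)) (- C (iter (N * k) A (x - iter i A x)));
       rewrite rnormN.
  rewrite big_split/= -!mulr_sumr lerD// ler_wpM2l//; first exact: hs.
  apply: le_trans (subseq_upper _ n) _; rewrite ler_wpM2l ?(ltW b0)//.
  rewrite /d -exprMn ler_pXn2r ?nnegrE ?mulr_ge0 ?rnorm_ge0//.
  apply: le_trans (iter_defect_le i x) _; rewrite ler_wpM2r ?rnorm_ge0// ler_nat.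
  exact: ltnW.
rewrite sumr_const card_ord -[_ *+ N]mulr_natr le_eqVlt; apply/orP; left; apply/eqP; ring.
Qed.

Lemma time_sums_upper : exists2 B, 0 <= B & forall x n,
  \sum_(k < n) Tobs k x <= B * rnorm x ^+ 2.
Proof.
have b1 := b0; have [D D0 hD] := gap_op 1 ltr01.
exists (2 * b + 2 * (b * (1 + 4 * D))).
  by rewrite addr_ge0// !mulr_ge0 ?(ltW b0)// addr_ge0 ?mulr_ge0.
move=> x n.
apply: (@le_trans _ _ (\sum_(k < n) (2 * obs (N * k) x +
    2 * rnorm (C (op_pow A (t k) x) - C (iter (N * k) A x)) ^+ 2))).
  apply: ler_sum => k _.
  have := rnorm_sqrD (C (iter (N * k) A x)) (C (op_pow A (t k) x) - C (iter (N * k) A x)).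
  by rewrite addrC subrK.
rewrite big_split/= -!mulr_sumr.
have h1 := subseq_upper x n; have h2 := hD x n.
have : rnorm (x - A x) ^+ 2 <= 4 * rnorm x ^+ 2.
  have := rnorm_sqrD x (- A x); rewrite rnormN.
  have : rnorm (A x) ^+ 2 <= rnorm x ^+ 2.
    by rewrite ler_pXn2r ?nnegrE ?rnorm_ge0//; case: hA => _ _; apply.
  lra.
move=> h3; have h4 := ler_wpM2l D0 h3.
have : b * (1 * rnorm x ^+ 2 + D * rnorm (x - A x) ^+ 2) <=
  b * (1 * rnorm x ^+ 2 + D * (4 * rnorm x ^+ 2)) by rewrite ler_wpM2l ?(ltW b0)// lerD2l.
lra.
Qed.

Lemma time_sums_lower : exists2 c, 0 < c & forall x s,
  (forall n, \sum_(k < n) Tobs k x <= s) -> c * rnorm x ^+ 2 <= s.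
Proof.
have a1 := a0; have b1 := b0.
have N0 : 0 < N%:R :> R by rewrite ltr0n.
(* The three accuracies, for the gap, the defect and the Muntz step, each cost at most [a / 4] of
   [a |x|^2]. The last quarter survives and is bounded by [Z s]; [q] is the total coefficient of the
   defect, and the [+ 1] keep denominators positive. *)
have [|D D0 hD] := gap_op (a / (16 * N%:R * b)); first by rewrite divr_gt0// !mulr_gt0.
pose q := 4 * N%:R * b * D + 2 * N%:R ^+ 3 * b.
have q0 : 0 <= q by rewrite addr_ge0// !mulr_ge0 ?exprn_ge0 ?(ltW b0).
have [|M [K K0 hK]] := defect_le (a / (4 * (q + 1))).
  by rewrite divr_gt0// mulr_gt0// ltr_wpDl.
have qK0 : 0 <= q * K by rewrite mulr_ge0.
have [|L L0 hL] := muntz_sum M (a / (4 * (q * K + 1))).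
  by rewrite divr_gt0// mulr_gt0// ltr_wpDl.
pose Z := 4 * N%:R + q * K * L.
have Z0 : 0 < Z by rewrite ltr_pwDl ?mulr_gt0// !mulr_ge0.
exists (a / (4 * Z)); first by rewrite divr_gt0// mulr_gt0.
move=> x s hs; set X := rnorm x ^+ 2; set d := rnorm (x - A x) ^+ 2.
have X0 : 0 <= X by exact: sqr_ge0.
have h1 := subseq_lower x (2 * s + 2 * (b * (a / (16 * N%:R * b) * X + D * d))).
have {}h1 : a * X <= 2 * N%:R * (2 * s + 2 * (b * (a / (16 * N%:R * b) * X + D * d))) +
    2 * N%:R ^+ 3 * b * d.
  apply: h1 => n.
  apply: (@le_trans _ _ (\sum_(k < n) (2 * Tobs k x +
      2 * rnorm (C (op_pow A (t k) x) - C (iter (N * k) A x)) ^+ 2))).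
    apply: ler_sum => k _.
    have := rnorm_sqrD (C (op_pow A (t k) x)) (- (C (op_pow A (t k) x) - C (iter (N * k) A x))).
    by rewrite rnormN opprB addrC subrK.
  rewrite big_split/= -!mulr_sumr lerD// ler_wpM2l//; [exact: hs|exact: hD].
have h2 : a * X <= 4 * N%:R * s + a / 4 * X + q * d.
  have : N%:R * b * (a / (16 * N%:R * b)) = a / 16.
    rewrite -(mulrA 16) invfM mulrC [a * _]mulrA divfK//.
    by rewrite mulf_neq0 ?gt_eqF.
  move: h1; rewrite /q; move: (a / (16 * N%:R * b)) => w h1 wE.
  have : N%:R * b * w * X = a / 16 * X by rewrite wE.
  lra.
have frac (p : R) : 0 <= p -> p * (a / (4 * (p + 1))) <= a / 4.
  move=> p0; rewrite mulrA ler_pdivrMr ?mulr_gt0 ?ltr_wpDl//.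
  have : 0 <= p * a by rewrite mulr_ge0// ltW.
  lra.
have h3 := ler_wpM2l q0 (hK x).
have h4 := ler_wpM2l qK0 (hL x s hs).
have h5 := ler_wpM2r X0 (frac q q0).
have h6 := ler_wpM2r X0 (frac (q * K) qK0).
rewrite mulrAC ler_pdivrMr ?mulr_gt0//.
rewrite -/X -/d in h3 h4; rewrite /Z; lra.
Qed.

End universal.
End observability.

Local Close Scope complex_scope.

(** * From the asymptotic hypothesis and extended sums to bounds on finite sums *)

Lemma littleo_quadratic_bound {R : realType} (d : nat -> R) :
  (forall k, 0 <= d k) ->
  (fun K : nat => \sum_(0 <= k < K.+1) d k : R^o) =o_\oo (fun K : nat => K%:R ^+ 2 : R^o) ->
  forall e, 0 < e -> exists2 C, 0 <= C &
    forall K, \sum_(k < K.+1) d k <= C + e * K%:R ^+ 2.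
Proof.
move=> d0 ho e e0.
have [K0 _ hK0] := (eqoP _ _ _).1 ho e e0.
have S0 K : 0 <= \sum_(k < K) d k by apply: sumr_ge0.
exists (\sum_(k < K0) d k) => // K.
have [KK|KK] := leqP K0 K.
  have := hK0 K KK; rewrite big_mkord ger0_norm//.
  rewrite ger0_norm ?sqr_ge0// => h; apply: le_trans h _.
  by rewrite lerDr.
rewrite (le_trans (fin_sum_le_widen d K.+1 K0 d0 KK))// lerDl.
by rewrite mulr_ge0 ?sqr_ge0// ltW.
Qed.

Lemma esum_nat_le {R : realType} (g : nat -> R) (s : R) : (forall k, 0 <= g k) ->
  (\esum_(k in [set: nat]) (g k)%:E <= s%:E)%E <-> forall n, \sum_(k < n) g k <= s.
Proof.
move=> g0.
have g0E k : (0 <= (g k)%:E)%E by rewrite lee_fin.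
rewrite -nneseries_esumT//; split=> [h n|h].
  rewrite -lee_fin; apply: le_trans h.
  have := @nneseries_lim_ge R (fun k => (g k)%:E) xpredT 0 n.
  by rewrite big_mkord -sumEFin; apply=> k _ _; exact: g0E.
apply: lime_le; first by apply: is_cvg_nneseries => k _ _; exact: g0E.
by apply: nearW => n; rewrite big_mkord sumEFin lee_fin.
Qed.

(** Quantifying over the upper bounds [s] of the partial sums stands for the value of the infinite
    sum and keeps the estimates in [R]. *)
Lemma exactly_observable_natP {R : realType} {H Y : completeNormedModType R[i]}
    (L : nat -> H -> Y) :
  exactly_observable [set: nat] L <-> exists a b : R, [/\ 0 < a, a <= b,
    forall x n, \sum_(k < n) rnorm (L k x) ^+ 2 <= b * rnorm x ^+ 2
  & forall x s, (forall n, \sum_(k < n) rnorm (L k x) ^+ 2 <= s) -> a * rnorm x ^+ 2 <= s].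
Proof.
have E x s := esum_nat_le (fun k => rnorm (L k x) ^+ 2) s (fun k => sqr_ge0 _).
split=> -[a [b [a0 ab]]].
  move=> h; exists a, b; split=> // x.
    by apply/E; have [] := h x.
  move=> s /E hs; rewrite -lee_fin; have [h1 _] := h x.
  exact: le_trans h1 hs.
move=> hu hl; exists a, b; split=> // x.
have ub : (\esum_(k in [set: nat]) (rnorm (L k x) ^+ 2)%:E <= (b * rnorm x ^+ 2)%:E)%E.
  by apply/E; exact: hu.
split=> //.
have lb : (0 <= \esum_(k in [set: nat]) (rnorm (L k x) ^+ 2)%:E)%E.
  by apply: esum_ge0 => k _; rewrite lee_fin sqr_ge0.
have fn : \esum_(k in [set: nat]) (rnorm (L k x) ^+ 2)%:E \is a fin_num.
  by rewrite ge0_fin_numE// (le_lt_trans ub)// ltry.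
rewrite -(fineK fn) lee_fin; by apply: hl; apply/E; rewrite fineK.
Qed.

Lemma exactly_observable_range {R : realType} {H Y : completeNormedModType R[i]}
    (t : nat -> R) (L : R -> H -> Y) : injective t ->
  exactly_observable [set: nat] (fun k => L (t k)) -> exactly_observable (range t) L.
Proof.
move=> tI [a [b [a0 ab h]]]; exists a, b; split=> // x.
rewrite (esum_image _ t (fun s => (rnorm (L s x) ^+ 2)%:E)); first exact: h.
by move=> i j _ _; exact: tI.
Qed.

Theorem theorem5p5 (R : realType) (T : set R) (t : nat -> R) (N : nat)
    (hlf : locally_finite_times T)
    (hinf : infinite_set T)
    (hT : T = range t)
    (hincr : forall m n : nat, (m < n)%N -> t m < t n)
    (ht0 : t 0%N = 0)
    (hN : (0 < N)%N)
    (ho : (fun K : nat => \sum_(0 <= k < K.+1) `|t k - (N * k)%:R| ^+ 2 : R^o)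
          =o_\oo (fun K : nat => K%:R ^+ 2 : R^o)) :
  (Q_series t N r @[r --> 1^'-] --> 0%E) /\ universal_times T.
Proof.
have dK := littleo_quadratic_bound (fun k => `|t k - (N * k)%:R| ^+ 2)
  (fun k => sqr_ge0 _) ho.
have dk e C : (forall K, \sum_(k < K.+1) `|t k - (N * k)%:R| ^+ 2 <= C + e * K%:R ^+ 2) ->
    forall k, `|t k - (N * k)%:R| ^+ 2 <= C + e * k%:R ^+ 2.
  move=> h k; apply: le_trans (h k); rewrite big_ord_recr/= lerDr.
  by apply: sumr_ge0 => i _; exact: sqr_ge0.
have tpos k : 0 < t k.+1 by rewrite -ht0 hincr.
have tI : injective t.
  by move=> m n mn; have [/hincr|/hincr|//] := ltngtP m n; rewrite mn ltxx.
have Nk k : k%:R <= (N * k)%:R :> R by rewrite ler_nat leq_pmull.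
have N1 : 1 <= N%:R :> R by rewrite ler1n.
(* For [k > k0], [16 C <= k] gives [|t k - N k| <= k / 2], hence [t k >= k / 2]; the remaining
   [k > 0] satisfy [t k >= t 1], which explains the second entry of the minimum. *)
have [c c0 [cN tc]] : exists2 c : R, 0 < c & c <= N%:R /\ forall k, c * k%:R <= t k.
  have [C C0 /dk hC] := dK (1 / 16) (divr_gt0 ltr01 (ltr0n _ 16)).
  have [k0 hk0] : exists k0 : nat, 16 * C + 1 <= k0.+1%:R.
    by exists (Num.trunc (16 * C + 1)); rewrite ltW// truncnS_gt.
  have k00 : 0 < k0.+1%:R :> R by [].
  pose c := Num.min (2^-1) (t 1%N / k0.+1%:R).
  exists c; first by rewrite lt_min invr_gt0 ltr0n divr_gt0.
  split; first by rewrite (le_trans _ N1)// ge_min invf_le1// ler1n.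
  move=> k; have [kk|kk] := leqP k0.+1 k.
    have k1 : k0.+1%:R <= k%:R :> R by rewrite ler_nat.
    have kp : 1 <= k%:R :> R by rewrite ler1n (leq_trans _ kk).
    have h : `|t k - (N * k)%:R| <= 2^-1 * k%:R.
      rewrite -(@ler_pXn2r _ 2) ?nnegrE ?mulr_ge0//; apply: le_trans (hC k) _.
      rewrite exprMn; have : k%:R <= k%:R ^+ 2 :> R by rewrite expr2 ler_peMl.
      by lra.
    have h2 : c * k%:R <= 2^-1 * k%:R by rewrite ler_wpM2r// ge_min lexx.
    by move: h; rewrite ler_norml => /andP[h _]; have := Nk k; lra.
  case: k kk => [|k] kk; first by rewrite mulr0 ht0.
  apply: (@le_trans _ _ (t 1%N)).
    apply: (@le_trans _ _ (t 1%N / k0.+1%:R * k.+1%:R)).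
      by rewrite ler_wpM2r// ge_min lexx orbT.
    rewrite mulrAC ler_pdivrMr// ler_wpM2l ?(ltW (tpos 0%N))// ler_nat.
    exact: ltnW.
  by case: k {kk} => // k; rewrite ltW// hincr.
(* The linear upper bound behind the divergence needed in Muntz' theorem; a single term of the
   hypothesis suffices, since [C + k^2 <= (C + 1)^2 k^2] for [k >= 1]. *)
have [C' C'0 uC] : exists2 C' : R, 0 < C' & forall i, t i.+1 <= C' * i.+1%:R.
  have [C C0 /dk hC] := dK 1 ltr01.
  exists (N%:R + (C + 1)); first by rewrite addr_gt0 ?ltr0n// ltr_wpDl.
  move=> i; have i1 : 1 <= i.+1%:R :> R by rewrite ler1n.
  have : `|t i.+1 - (N * i.+1)%:R| <= (C + 1) * i.+1%:R.
    rewrite -(@ler_pXn2r _ 2) ?nnegrE ?mulr_ge0 ?addr_ge0//.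
    apply: le_trans (hC _) _; rewrite mul1r exprMn.
    have i2 : 1 <= i.+1%:R ^+ 2 :> R by rewrite exprn_ege1.
    have : (C + 1) * i.+1%:R ^+ 2 <= (C + 1) ^+ 2 * i.+1%:R ^+ 2.
      by rewrite ler_wpM2r ?sqr_ge0// expr2 ler_peMl ?addr_ge0// lerDr.
    have : C * 1 <= C * i.+1%:R ^+ 2 by rewrite ler_wpM2l.
    lra.
  by rewrite ler_norml natrM mulrDl => /andP[_]; lra.
have gap := power_gap_bound t N c c0 ht0 tc cN dK.
have prod0 q e : 0 < q -> 0 < e -> exists n, \prod_(i < n) `|1 - q / t i.+1| <= e.
  move=> q0 e0; apply: (@prod_one_minus_cvg0 R (fun i => t i.+1) q C') => //.
  move=> B; exists (Num.trunc (B / c)).+1 => i hi.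
  apply: le_trans (tc _); rewrite mulrC -ler_pdivrMr//.
  by rewrite ltW// (lt_le_trans (truncnS_gt _))// ler_nat (leq_trans hi).
split.
  have Qge r : (0 <= Q_series t N r)%E.
    by apply: nneseries_ge0 => k _ _; rewrite lee_fin sqr_ge0.
  have Qle r s : (forall n, \sum_(k < n) (r `^ t k - r ^+ (N * k)) ^+ 2 <= s) ->
      (Q_series t N r <= s%:E)%E.
    move=> h; rewrite /Q_series.
    under eq_eseriesr do rewrite real_normK ?num_real//.
    rewrite nneseries_esumT; last by move=> k; rewrite lee_fin sqr_ge0.
    exact/(esum_nat_le (fun k => (r `^ t k - r ^+ (N * k)) ^+ 2) s (fun k => sqr_ge0 _)).
  have small e : 0 < e -> \forall r \near 1^'-, (Q_series t N r <= e%:E)%E.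
    move=> e0; have [D D0 hD] := gap (e / 2) (divr_gt0 e0 (ltr0n _ 2)).
    (* As [d <= 1], [1 - r < d] gives both [0 < r] and [(1 - r)^2 <= d], so
       [D (1 - r)^2 <= e / 2]. *)
    pose d := Num.min 1 (e / (2 * (D + 1))).
    have D1 : 0 < 2 * (D + 1) by lra.
    have d0 : 0 < d by rewrite lt_min ltr01 divr_gt0.
    near=> r.
    have r1 : r < 1 by near: r; exact: nbhs_left_lt.
    have rd : 1 - d < r by near: r; apply: nbhs_left_gt; rewrite ltrBlDr ltrDl.
    have d1 : d <= 1 by rewrite ge_min lexx.
    apply: Qle => n; apply: le_trans (hD r _ n) _; first by apply/andP; split; lra.
    have h1 : (1 - r) ^+ 2 <= d.
      rewrite expr2 -[leRHS]mul1r ler_pM//; lra.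
    have h2 : d <= e / (2 * (D + 1)) by rewrite ge_min lexx orbT.
    have h3 : D * (1 - r) ^+ 2 <= D * (e / (2 * (D + 1))).
      by rewrite ler_wpM2l// (le_trans h1).
    have h4 : D * (e / (2 * (D + 1))) <= e / 2.
      rewrite mulrA ler_pdivrMr//; lra.
    lra.
  apply/fine_cvgP; split.
    have := small 1 ltr01; apply: filterS => r hr.
    by rewrite ge0_fin_numE// (le_lt_trans hr)// ltry.
  apply/cvgrPdist_le => e e0; have := small e e0; apply: filterS => r hr.
  rewrite sub0r normrN ger0_norm ?fine_ge0//= -lee_fin fineK//.
  by rewrite ge0_fin_numE// (le_lt_trans hr)// ltry.
split=> // H Y dotH dotY hdH _ _ _ A C posA _ /exactly_observable_natP[a [b [a0 ab up lo]]].
have hA := observable_contraction dotH hdH A C a b a0 up lo posA.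
rewrite hT; apply: exactly_observable_range => //; apply/exactly_observable_natP.
have [B B0 hB] := time_sums_upper dotH hdH A C a b a0 ab up hA t N hN ht0 tpos gap.
have [d d0 hd] := time_sums_lower dotH hdH A C a b a0 ab up lo hA t N hN ht0 tpos tI gap prod0.
exists d, (Num.max d B); split=> // [|x n]; first by rewrite le_max lexx.
by rewrite (le_trans (hB x n))// ler_wpM2r ?sqr_ge0// le_max lexx orbT.
Unshelve. all: by end_near.
Qed.
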